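(* Let $z_l,z_r\in\mathbb S^3$ be unit quaternions. There is a homeomorphism $\gamma\mapsto(\gamma_l,\gamma_r)$ between the space $\mathcal G\mathbb S^3(z_l,z_r)$ and the space of pairs of curves $(\gamma_l,\gamma_r)\in\mathcal G\mathbb S^2(z_l)\times\mathcal G\mathbb S^2(z_r)$ satisfying $$\|\gamma_l'(t)\|=\|\gamma_r'(t)\|,\qquad \kappa_{\gamma_l}(t)>\kappa_{\gamma_r}(t),\qquad t\in[0,1].\qquad( * )$$ Moreover, given $\gamma\in\mathcal G\mathbb S^3(z_l,z_r)$, the curves $\gamma_l$ and $\gamma_r$ satisfy $$\|\gamma_l'(t)\|=\|\gamma_r'(t)\|=\|\gamma'(t)\|\kappa_\gamma(t),\quad \kappa_{\gamma_l}(t)=\frac{\tau_\gamma(t)+1}{\kappa_\gamma(t)},\quad \kappa_{\gamma_r}(t)=\frac{\tau_\gamma(t)-1}{\kappa_\gamma(t)},$$ and, given a pair $(\gamma_l,\gamma_r)\in\mathcal G\mathbb S^2(z_l)\times\mathcal G\mathbb S^2(z_r)$ satisfying $( * )$, the corresponding curve $\gamma$ satisfies $$\|\gamma'(t)\|=\frac{\|\gamma_l'(t)\|(\kappa_{\gamma_l}(t)-\kappa_{\gamma_r}(t))}{2},\quad \kappa_\gamma(t)=\frac{2}{\kappa_{\gamma_l}(t)-\kappa_{\gamma_r}(t)},\quad \tau_\gamma(t)=\frac{\kappa_{\gamma_l}(t)+\kappa_{\gamma_r}(t)}{\kappa_{\gamma_l}(t)-\kappa_{\gamma_r}(t)}.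$$
   Context: For $n\in\{2,3\}$, a smooth curve $\gamma:[0,1]\to\mathbb S^n\subset\mathbb R^{n+1}$ is generic if $\gamma(t),\gamma'(t),\dots,\gamma^{(n-1)}(t)$ are linearly independent for all $t\in[0,1]$. Its Frenet frame $\mathcal F_\gamma(t)\in SO_{n+1}$ is the matrix whose first $n$ columns are obtained by Gram–Schmidt orthonormalization of $\gamma(t),\gamma'(t),\dots,\gamma^{(n-1)}(t)$ and whose last column completes them to a positively oriented orthonormal basis. $\mathbb H$ denotes the quaternions with basis $\mathbf 1,\mathbf i,\mathbf j,\mathbf k$, and $\mathbb S^3$ is identified with the unit quaternions. $\mathrm{Spin}_3\simeq\mathbb S^3$ with covering $\Pi_3:\mathbb S^3\to SO_3$, $\Pi_3(z)h=zh\bar z$ for $h\in\mathrm{Im}\,\mathbb H\simeq\mathbb R^3$ (basis $\mathbf i,\mathbf j,\mathbf k$); $\mathrm{Spin}_4\simeq\mathbb S^3\times\mathbb S^3$ with covering $\Pi_4:\mathbb S^3\times\mathbb S^3\to SO_4$, $\Pi_4(z_l,z_r)q=z_lq\bar z_r$ for $q\in\mathbb H\simeq\mathbb R^4$ (basis $\mathbf 1,\mathbf i,\mathbf j,\mathbf k$). If $\mathcal F_\gamma(0)=I$, the lifted Frenet frame $\tilde{\mathcal F}_\gamma:[0,1]\to\mathrm{Spin}_{n+1}$ is the unique continuous lift of $\mathcal F_\gamma$ starting at the unit element ($\mathbf 1$ for $n=2$, $(\mathbf 1,\mathbf 1)$ for $n=3$). $\mathcal G\mathbb S^2(z)$ is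 the space of generic curves $\gamma:[0,1]\to\mathbb S^2$ with $\mathcal F_\gamma(0)=I$, $\tilde{\mathcal F}_\gamma(1)=z$. $\mathcal G\mathbb S^3(z_l,z_r)$ is the space of generic curves $\gamma:[0,1]\to\mathbb S^3$ with $\mathcal F_\gamma(0)=I$, $\tilde{\mathcal F}_\gamma(1)=(z_l,z_r)$. Topology: these spaces of curves in $\mathbb S^n$ carry the $C^k$ topology for an integer $k\ge n$ (the particular choice of $k$ being regarded as unimportant). By convention each is identified, via an inclusion that is a homotopy equivalence, with the following larger Hilbert manifold version, denoted by the same symbol. For a generic curve with $\mathcal F_\gamma(0)=I$, the matrix $\Lambda_\gamma=\mathcal F_\gamma^{-1}\mathcal F_\gamma'$ is tridiagonal and skew-symmetric with subdiagonal entries $c_1,\dots,c_n$, where $c_1,\dots,c_{n-1}>0$ and $c_n$ is real. The larger space consists of the curves $\gamma=\mathcal F_\gamma e_1$ (with $e_1$ the first canonical basis vector) obtained by solving $\mathcal F_\gamma'=\mathcal F_\gamma\Lambda_\gamma$, $\mathcal F_\gamma(0)=I$, with $c_i-1/c_i\in L^2([0,1])$ for $i<n$ and $c_n\in L^2([0,1])$; it is topologized through these $n$ functions in $L^2([0,1],\mathbb R^n)$, and the prescribed final lifted frame cuts out a closed subset. The space of pairs has the topology induced from the product. Curvatures: for $n=2$ write $\mathcal F_\gamma=(\gamma,\mathbf t_\gamma,\mathbf n_\gamma)$ and for $n=3$ write $\mathcal F_\gamma=(\gamma,\mathbf t_\gamma,\mathbf n_\gamma,\mathbf b_\gamma)$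 (columns). The geodesic curvature is $\kappa_\gamma(t)=\mathbf t_\gamma'(t)\cdot\mathbf n_\gamma(t)/\|\gamma'(t)\|$, and for $n=3$ the geodesic torsion is $\tau_\gamma(t)=-\mathbf b_\gamma'(t)\cdot\mathbf n_\gamma(t)/\|\gamma'(t)\|$.
   Formalization: The curve spaces consist of smooth curves with the C^∞ topology (all C^k together) instead of a fixed C^k or the Hilbert manifold version, where the map is not a homeomorphism; continuity from C^{k+1} to C^k in both directions is added for k ≥ 3. *)

(* Defs.v *)
From HB Require Import structures.
From mathcomp Require Import all_boot all_order all_algebra.
From mathcomp Require Import all_classical all_reals all_analysis.

Set Implicit Arguments.
Unset Strict Implicit.
Unset Printing Implicit Defensive.

Import Order.TTheory GRing.Theory Num.Theory.
Import numFieldNormedType.Exports.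
Local Open Scope classical_set_scope.
Local Open Scope ring_scope.

Section Euclidean.
Context {R : realType}.

Definition dot {m} (u v : 'cV[R]_m) : R := \sum_i u i 0 * v i 0.

(* The library norm of a matrix is the sup norm, hence this definition. *)
Definition enorm {m} (u : 'cV[R]_m) : R := Num.sqrt (dot u u).

Definition gram_schmidt {m} (s : seq 'cV[R]_m) : seq 'cV[R]_m :=
  foldl (fun e v => let w := v - \sum_(u <- e) dot v u *: u in
                    rcons e ((enorm w)^-1 *: w)) [::] s.

Definition SO (m : nat) : set 'M[R]_m :=
  [set M | M^T *m M = 1%:M /\ \det M = 1].

End Euclidean.

(* Quaternions are column vectors of R^4 in the basis 1, i, j, k, and imaginary
   quaternions are column vectors of R^3 in the basis i, j, k. *)
Section Quaternions.
Context {R : realType}.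

Definition quat (a b c d : R) : 'cV[R]_4 := \col_i [:: a; b; c; d]`_i.

Definition qone : 'cV[R]_4 := quat 1 0 0 0.

Definition qmul (p q : 'cV[R]_4) : 'cV[R]_4 :=
  let p_ i := p (inord i) 0 in let q_ i := q (inord i) 0 in
  quat (p_ 0%N * q_ 0%N - p_ 1%N * q_ 1%N - p_ 2%N * q_ 2%N - p_ 3%N * q_ 3%N)
       (p_ 0%N * q_ 1%N + p_ 1%N * q_ 0%N + p_ 2%N * q_ 3%N - p_ 3%N * q_ 2%N)
       (p_ 0%N * q_ 2%N - p_ 1%N * q_ 3%N + p_ 2%N * q_ 0%N + p_ 3%N * q_ 1%N)
       (p_ 0%N * q_ 3%N + p_ 1%N * q_ 2%N - p_ 2%N * q_ 1%N + p_ 3%N * q_ 0%N).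

Definition qconj (q : 'cV[R]_4) : 'cV[R]_4 :=
  let q_ i := q (inord i) 0 in quat (q_ 0%N) (- q_ 1%N) (- q_ 2%N) (- q_ 3%N).

Definition unit_quat : set 'cV[R]_4 := [set q | enorm q = 1].

Definition imq (h : 'cV[R]_3) : 'cV[R]_4 :=
  quat 0 (h (inord 0) 0) (h (inord 1) 0) (h (inord 2) 0).

Definition Pi3 (z : 'cV[R]_4) : 'M[R]_3 :=
  \matrix_(i, j)
    qmul (qmul z (imq (delta_mx j 0))) (qconj z) (lift ord0 i) 0.

Definition Pi4 (zl zr : 'cV[R]_4) : 'M[R]_4 :=
  \matrix_(i, j) qmul (qmul zl (delta_mx j 0)) (qconj zr) i 0.

End Quaternions.

Section Curves.
Context {R : realType}.

Definition I01 : set R := `[0, 1].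

Lemma I01_0 : (0 : R) \in I01.
Proof. by rewrite inE /I01 /= in_itv /= lexx ler01. Qed.

Lemma I01_1 : (1 : R) \in I01.
Proof. by rewrite inE /I01 /= in_itv /= lexx ler01. Qed.

Definition t0 : I01 := exist _ 0 I01_0.
Definition t1 : I01 := exist _ 1 I01_1.

(* The limits below are taken in the topology of [0,1]: derivatives are
   one-sided at the endpoints. *)
Definition diff_quot {m} (f : I01 -> 'cV[R]_m.+1) (t s : I01) : 'cV[R]_m.+1 :=
  (val s - val t)^-1 *: (f s - f t).

Definition cderiv {m} (f : I01 -> 'cV[R]_m.+1) (t : I01) : 'cV[R]_m.+1 :=
  lim (diff_quot f t @ t^').

Definition cderivn {m} (k : nat) (f : I01 -> 'cV[R]_m.+1) :
  I01 -> 'cV[R]_m.+1 := iter k cderiv f.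

Definition smooth {m} (f : I01 -> 'cV[R]_m.+1) : Prop :=
  forall (k : nat) (t : I01), cvg (diff_quot (cderivn k f) t @ t^').

Definition on_sphere {n} (g : I01 -> 'cV[R]_n.+1) : Prop :=
  forall t, enorm (g t) = 1.

Definition generic {n} (g : I01 -> 'cV[R]_n.+1) : Prop :=
  forall t, row_free (\matrix_(k < n) (cderivn k g t)^T).

(* For a generic curve exactly one matrix satisfies the condition below. *)
Definition frenet {n} (g : I01 -> 'cV[R]_n.+1) (t : I01) : 'M[R]_n.+1 :=
  get [set M | SO M /\
    forall i : 'I_n, col (widen_ord (leqnSn n) i) M =
      (gram_schmidt [seq cderivn k g t | k <- iota 0 n])`_i].

Definition frenet_col {n} (j : nat) (g : I01 -> 'cV[R]_n.+1) (t : I01) :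
  'cV[R]_n.+1 := col (inord j) (frenet g t).

Definition speed {n} (g : I01 -> 'cV[R]_n.+1) (t : I01) : R :=
  enorm (cderiv g t).

(* Columns 0, 1, 2, 3 of the Frenet frame are the curve, t, n and b. *)
Definition kappa {n} (g : I01 -> 'cV[R]_n.+1) (t : I01) : R :=
  dot (cderiv (frenet_col 1 g) t) (frenet_col 2 g t) / speed g t.

Definition tau (g : I01 -> 'cV[R]_4) (t : I01) : R :=
  - dot (cderiv (frenet_col 3 g) t) (frenet_col 2 g t) / speed g t.

Definition is_lift3 (F : I01 -> 'M[R]_3) (z : I01 -> 'cV[R]_4) : Prop :=
  [/\ continuous z, forall t, unit_quat (z t), z t0 = qone
    & forall t, Pi3 (z t) = F t].

Definition is_lift4 (F : I01 -> 'M[R]_4) (zl zr : I01 -> 'cV[R]_4) : Prop :=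
  [/\ continuous zl /\ continuous zr,
      forall t, unit_quat (zl t) /\ unit_quat (zr t),
      zl t0 = qone /\ zr t0 = qone
    & forall t, Pi4 (zl t) (zr t) = F t].

(* A continuous lift with a given initial value is unique, so the existential
   below is a condition on the final value of the lifted Frenet frame. *)
Definition in_GS2 (z : 'cV[R]_4) (g : I01 -> 'cV[R]_3) : Prop :=
  [/\ on_sphere g, generic g, frenet g t0 = 1%:M
    & exists zt, is_lift3 (frenet g) zt /\ zt t1 = z].

Definition in_GS3 (zl zr : 'cV[R]_4) (g : I01 -> 'cV[R]_4) : Prop :=
  [/\ on_sphere g, generic g, frenet g t0 = 1%:M
    & exists zlt zrt, is_lift4 (frenet g) zlt zrt /\ (zlt t1, zrt t1) = (zl, zr)].

End Curves.
Arguments I01 : clear implicits.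

(* [smooth_curve K n] is the set of smooth curves in R^(n+1), with the topology
   of uniform convergence of the derivatives whose order lies in [K]: the
   carrier does not depend on [K], only the topology does. *)
Definition smooth_curve (R : realType) (K : set nat) (n : nat) : Type :=
  set_type [set g : I01 R -> 'cV[R]_n.+1 | smooth g].

Definition jet (R : realType) (K : set nat) (n : nat)
    (g : smooth_curve R K n) :
    prod_topology (fun _ : K => {uniform I01 R -> 'cV[R]_n.+1}) :=
  fun k => cderivn (val k) (val g).

HB.instance Definition _ (R : realType) (K : set nat) (n : nat) :=
  Topological.copy (smooth_curve R K n) (initial_topology (@jet R K n)).

(* For a fixed k the correspondence below is not a homeomorphism between C^k
   topologies: the speed of the curves in S^2 is a second-order quantity of the
   curve in S^3, and conversely, so one derivative is lost in each direction. *)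
Definition Ck (k : nat) : set nat := [set i | (i <= k)%N].

(* The coarsest topology finer than all the C^k topologies. *)
Definition Cinfty : set nat := setT.

Definition GS2 (R : realType) (K : set nat) (z : 'cV[R]_4) :
    set (smooth_curve R K 2) :=
  [set g | in_GS2 z (val g)].

Arguments GS2 {R} K z.

Definition GS3 (R : realType) (K : set nat) (zl zr : 'cV[R]_4) :
    set (smooth_curve R K 3) :=
  [set g | in_GS3 zl zr (val g)].

Arguments GS3 {R} K zl zr.

Definition curve3 (R : realType) (K : set nat) (zl zr : 'cV[R]_4)
  (g : GS3 K zl zr) : I01 R -> 'cV[R]_4 := val (val g).

Definition curve2 (R : realType) (K : set nat) (z : 'cV[R]_4)
  (g : GS2 K z) : I01 R -> 'cV[R]_3 := val (val g).

Definition GS2pairs (R : realType) (K : set nat) (zl zr : 'cV[R]_4) :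
    set (GS2 K zl * GS2 K zr)%type :=
  [set p | forall t, speed (curve2 p.1) t = speed (curve2 p.2) t /\
                     kappa (curve2 p.2) t < kappa (curve2 p.1) t].

Arguments GS2pairs {R} K zl zr.

Definition left_curve (R : realType) (K : set nat) (zl zr : 'cV[R]_4)
  (p : GS2pairs K zl zr) : I01 R -> 'cV[R]_3 := curve2 (val p).1.

Definition right_curve (R : realType) (K : set nat) (zl zr : 'cV[R]_4)
  (p : GS2pairs K zl zr) : I01 R -> 'cV[R]_3 := curve2 (val p).2.

(* Main.v *)
Require Import Defs.
From mathcomp Require Import all_boot all_order all_algebra.
From mathcomp Require Import all_classical all_reals all_analysis.
From mathcomp Require Import ring lra.

Set Implicit Arguments.
Unset Strict Implicit.
Unset Printing Implicit Defensive.

Import Order.TTheory GRing.Theory Num.Theory.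
Import numFieldNormedType.Exports.
Local Open Scope classical_set_scope.
Local Open Scope ring_scope.

(* Let (z_l, z_r) be the lifted Frenet frame of a curve g in S^3, so that the
   columns of the frame are z_l q conj(z_r) for q = 1, i, j, k. Then
   t conj(g) = z_l i conj(z_l) and conj(g) t = z_r i conj(z_r) are curves in S^2
   whose frames are Pi3 z_l and Pi3 z_r: this defines the map g |-> (g_l, g_r)
   without lifts, and the Frenet equations of g give those of g_l and g_r.
   Conversely, g = z_l conj(z_r), where z_l and z_r are the lifts of the frames of
   g_l and g_r; they satisfy z' = z (v/2) (kappa i + k), v being the speed.
   Continuity is proved for families of curves: as [0,1] is compact, a family is
   continuous for the topology of uniform convergence iff it is jointly continuous,
   and joint continuity (of t-derivatives) is preserved by algebraic operations.
   The lift z is recovered from its frame because z i conj(z), z j conj(z) and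
   z k conj(z) determine linearly the projection q |-> <z, q> z. *)

(** * Differential calculus on the unit interval *)

(** If z' = z w with w imaginary, then z q conj(z) has derivative z (w q - q w) conj(z), so w is
    found from its commutators with i and j; these double its coordinates, hence the half in the
    equation of the lift. For g = z_l conj(z_r) this gives g' = z_l (w_l - w_r) conj(z_r): equal
    speeds cancel the k-components, and the inequality between the curvatures makes the remaining
    multiple of i positive. This is where the condition on pairs comes from. A lift is given only as
    a continuous map and [frenet] only as a choice from a set. Differentiability of the lift must
    therefore be derived from that of the frame, and frames are identified by exhibiting a rotation
    in whose columns the derivatives of the curve are triangular with positive diagonal. Each
    direction costs one derivative, since the two parts of g, and likewise the frames of g_l and
    g_r, involve a tangent. Continuity is thus proved with one set of orders for the source and
    another for the target, which settles the two kinds of topologies together. *)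

Section UnitInterval.
Context {R : realType}.
Local Notation I := (I01 R).

(** Retraction of the line onto [0,1]: it extends functions on [I] to [R], where the intermediate
    value theorem and compactness of segments are available. *)
Definition clamp (x : R) : R := Num.max 0 (Num.min x 1).

Lemma clamp_itv x : clamp x \in I.
Proof.
rewrite inE /I01 /= in_itv /= /clamp le_max lexx /= ge_max ler01 /=.
by rewrite ge_min lexx orbT.
Qed.

Definition to_I (x : R) : I := exist _ (clamp x) (clamp_itv x).

Lemma I_itv (t : I) : 0 <= val t <= 1.
Proof. by case: t => t /=; rewrite inE /I01 /= in_itv. Qed.

Lemma to_IK (t : I) : to_I (val t) = t.
Proof.
apply: val_inj => /=; have /andP[t_ge0 t_le1] := I_itv t.
by rewrite /clamp min_l // max_r.
Qed.

Lemma clamp_id (x : R) : 0 <= x <= 1 -> clamp x = x.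
Proof. by move=> /andP[x0 x1]; rewrite /clamp min_l // max_r. Qed.

Lemma val_I_continuous : continuous (fun t : I => val t : R).
Proof. exact: initial_continuous. Qed.

Lemma clamp_continuous : continuous clamp.
Proof.
pose f0 : R -> R := fun=> 0; pose f1 : R -> R := fun=> 1.
move=> x; have c0 : {for x, continuous f0} by exact: cvg_cst.
have c1 : {for x, continuous f1} by exact: cvg_cst.
have ci : {for x, continuous (id : R -> R)} by exact: cvg_id.
exact: (continuous_max c0 (continuous_min ci c1)).
Qed.

Lemma to_I_continuous : continuous to_I.
Proof.
by apply: (@continuous_comp_initial _ _ _ set_val to_I); exact: clamp_continuous.
Qed.

Lemma I_compact : compact [set: I].
Proof.
have -> : [set: I] = to_I @` `[0, 1].
  apply/seteqP; split => // t _; exists (val t); last exact: to_IK.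
  by rewrite /= in_itv /= I_itv.
apply: continuous_compact; last exact: segment_compact.
exact/continuous_subspaceT/to_I_continuous.
Qed.

(** No point of [0,1] is isolated, endpoints included; this makes the limits defining derivatives
    unique. *)
Global Instance I_dnbhs_proper (t : I) : ProperFilter (t^').
Proof.
apply: Build_ProperFilter_ex => A [_ [[V oV <-] /= Vt VA]].
have [e /= e0 eV] : nbhs_ball (val t : R) V.
  by apply/nbhs_ballP/open_nbhs_nbhs.
have /andP[t_ge0 t_le1] := I_itv t.
have [d [d0 de d1]] : exists d : R, [/\ 0 < d, d < e & d <= 1 / 2].
  exists (Num.min (e / 2) (1 / 2)); split; first by rewrite lt_min !divr_gt0.
    by rewrite gt_min; apply/orP; left; lra.
  by rewrite ge_min lexx orbT.
(* Moving towards the farther endpoint, by at most 1/2, stays inside [0,1]. *)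
pose x : R := if val t <= 1 / 2 then val t + d else val t - d.
have x01 : 0 <= x <= 1 by rewrite /x; case: (leP (val t) (1 / 2)) => h; apply/andP; split; lra.
have xt : `|val t - x| = d.
  rewrite /x; case: ifP => _; first by rewrite opprD addNKr normrN gtr0_norm.
  by rewrite opprB addrC subrK gtr0_norm.
have vx : val (to_I x) = x by rewrite /= clamp_id.
exists (to_I x); apply: VA.
  by apply: eV; rewrite -vx in xt; rewrite /ball /= xt.
by apply/eqP => /(congr1 val); rewrite vx => xE; move: xt; rewrite xE subrr normr0; lra.
Qed.

Lemma continuous_nowhere_zero_gt0 (f : I -> R) :
  continuous f -> 0 < f t0 -> (forall t, f t != 0) -> forall t, 0 < f t.
Proof.
move=> fc f0 fn0 t; rewrite ltNge; apply/negP => ft.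
have t_ge0 : 0 <= val t by case/andP: (I_itv t).
have [||c _ /eqP] := @IVT R (f \o to_I) 0 (val t) 0 t_ge0.
- apply/continuous_subspaceT => x.
  by apply: continuous_comp; [exact: to_I_continuous|exact: fc].
- rewrite /= to_IK.
  have -> : to_I 0 = t0 by apply: val_inj; rewrite /= clamp_id // lexx ler01.
  by rewrite ge_min le_max ft orbT (ltW f0).
- by rewrite (negPf (fn0 _)).
Qed.

End UnitInterval.

Section Derivative.
Context {R : realType}.
Local Notation I := (I01 R).

Definition isder (f : I -> R) (t : I) (l : R) : Prop :=
  (fun s => (val s - val t)^-1 * (f s - f t)) @ t^' --> l.

Lemma isder_unique f t l1 l2 : isder f t l1 -> isder f t l2 -> l1 = l2.
Proof. exact: cvg_unique. Qed.

Lemma val_neq (s t : I) : s != t -> val s - val t != 0.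
Proof. by apply: contra; rewrite subr_eq0 => /eqP/val_inj ->. Qed.

Lemma near_dnbhs_neq (t : I) : \forall s \near t^', s != t.
Proof. exact: withinT. Qed.

Lemma isder_cvg f t l : isder f t l -> f @ t^' --> f t.
Proof.
move=> fl.
have vt : (fun s : I => val s : R) @ t^' --> (val t : R).
  by apply: cvg_within_filter; exact: val_I_continuous.
have h : (fun s : I => f t + (val s - val t) *
    ((val s - val t)^-1 * (f s - f t))) @ t^' --> f t + (val t - val t) * l.
  apply: cvgD; first exact: cvg_cst.
  by apply: cvgM => //; apply: cvgB => //; exact: cvg_cst.
rewrite subrr mul0r addr0 in h; apply: cvg_trans h; apply: near_eq_cvg.
near=> s; have st : s != t by near: s; exact: near_dnbhs_neq.
by rewrite mulrA mulfV ?val_neq // mul1r addrCA subrr addr0.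
Unshelve. all: by end_near. Qed.

Lemma isder_continuous f : (forall t, exists l, isder f t l) -> continuous f.
Proof.
move=> fd t; have [l fl] := fd t.
by apply/continuous_withinNx; exact: isder_cvg fl.
Qed.

Lemma isder_near (f : I -> R) (t : I) l (q : I -> R) :
  (\forall s \near t^', q s = (val s - val t)^-1 * (f s - f t)) ->
  q @ t^' --> l -> isder f t l.
Proof. by move=> e; apply: cvg_trans; exact: near_eq_cvg e. Qed.

Lemma isder_cst (a : R) t : isder (fun=> a) t 0.
Proof.
rewrite /isder; have -> : (fun s : I => (val s - val t)^-1 * (a - a)) = fun=> 0.
  by apply/funext => s; rewrite subrr mulr0.
exact: cvg_cst.
Qed.

Lemma isderD f g t a b : isder f t a -> isder g t b ->
  isder (fun s => f s + g s) t (a + b).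
Proof.
move=> fa gb; apply: isder_near (cvgD fa gb).
by apply: nearW => s; rewrite !fctE /=; ring.
Qed.

Lemma isderM f g t a b : isder f t a -> isder g t b ->
  isder (fun s => f s * g s) t (a * g t + f t * b).
Proof.
move=> fa gb.
have ft : (fun=> f t : R) @ t^' --> f t by exact: cvg_cst.
apply: isder_near (cvgD (cvgM fa (isder_cvg gb)) (cvgM ft gb)).
by apply: nearW => s; rewrite !fctE /=; ring.
Qed.

Lemma isderN f t a : isder f t a -> isder (fun s => - f s) t (- a).
Proof.
move=> fa; apply: isder_near (cvgN fa).
by apply: nearW => s; rewrite !fctE /=; ring.
Qed.

Lemma isderV f t a : (forall s, f s != 0) -> isder f t a ->
  isder (fun s => (f s)^-1) t (- (a * ((f t)^-1 * (f t)^-1))).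
Proof.
move=> f0 fa.
have ft : (fun=> (f t)^-1 : R) @ t^' --> (f t)^-1 by exact: cvg_cst.
apply: isder_near (cvgN (cvgM fa (cvgM (cvgV (f0 t) (isder_cvg fa)) ft))).
near=> s; rewrite !fctE /=.
have st : s != t by near: s; exact: near_dnbhs_neq.
by have := val_neq st; have := f0 s; have := f0 t => ? ? ?; field; apply/and3P.
Unshelve. all: by end_near. Qed.

(** Multiplying by the conjugate turns the difference quotient into that of [f] divided by the sum
    of the two roots. *)
Lemma isder_sqrt f t a : (forall s, 0 < f s) -> isder f t a ->
  isder (fun s => Num.sqrt (f s)) t (a * (Num.sqrt (f t) + Num.sqrt (f t))^-1).
Proof.
move=> f0 fa.
have p s : 0 < Num.sqrt (f s) by rewrite sqrtr_gt0.
have ct : (fun s => Num.sqrt (f s)) @ t^' --> Num.sqrt (f t).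
  apply: continuous_cvg; [exact: sqrt_continuous|exact: isder_cvg fa].
have cc : (fun=> Num.sqrt (f t) : R) @ t^' --> Num.sqrt (f t) by exact: cvg_cst.
have n0 s : Num.sqrt (f s) + Num.sqrt (f t) != 0 by rewrite gt_eqF ?addr_gt0.
apply: isder_near (cvgM fa (cvgV (n0 t) (cvgD ct cc))); apply: nearW => s /=; rewrite !fctE /=.
have -> : f s - f t = (Num.sqrt (f s) - Num.sqrt (f t)) * (Num.sqrt (f s) + Num.sqrt (f t)).
  by rewrite -subr_sqr !sqr_sqrtr // ltW.
by rewrite mulrA mulfK.
Qed.

Definition vder {m} (g : I -> 'cV[R]_m) (t : I) (l : 'cV[R]_m) : Prop :=
  forall i, isder (fun s => g s i 0) t (l i 0).

Lemma cvg_colP {T} (F : set_system T) {FF : Filter F} m (g : T -> 'cV[R]_m.+1)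
    (l : 'cV[R]_m.+1) :
  (forall i, (fun s => g s i 0) @ F --> l i 0) <-> g @ F --> l.
Proof.
split=> h; last first.
  by move=> i; exact: (continuous_cvg _ (@coord_continuous _ _ _ i 0 l) h).
apply/cvg_ballP => e e0.
have : \forall s \near F, forall i, ball (l i 0) e (g s i 0).
  by apply: filter_forall => i; exact: (cvg_ball (h i)).
apply: filterS => s hs; split => // i j.
by rewrite !ord1.
Qed.

Lemma vderP m (g : I -> 'cV[R]_m.+1) t l :
  vder g t l <-> diff_quot g t @ t^' --> l.
Proof.
rewrite -cvg_colP; split=> h i; have := h i; rewrite /isder /diff_quot;
  apply: cvg_trans; apply: near_eq_cvg; apply: nearW => s /=; by rewrite !mxE.
Qed.

Lemma vder_unique m (g : I -> 'cV[R]_m) t l1 l2 :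
  vder g t l1 -> vder g t l2 -> l1 = l2.
Proof.
move=> h1 h2; apply/colP => i; exact: isder_unique (h1 i) (h2 i).
Qed.

Lemma cderivE m (g : I -> 'cV[R]_m.+1) t l : vder g t l -> cderiv g t = l.
Proof. by move=> /vderP; exact: cvg_lim. Qed.

Lemma vder_cderiv m (g : I -> 'cV[R]_m.+1) t l : vder g t l -> vder g t (cderiv g t).
Proof. by move=> gl; rewrite (cderivE gl). Qed.

Lemma smooth_vder m (g : I -> 'cV[R]_m.+1) k t : smooth g ->
  vder (cderivn k g) t (cderivn k.+1 g t).
Proof. by move=> /(_ k t) h; apply/vderP. Qed.

Lemma smooth_cderiv m (g : I -> 'cV[R]_m.+1) : smooth g -> smooth (cderiv g).
Proof. by move=> gs k t; have := gs k.+1 t; rewrite /cderivn iterSr. Qed.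

End Derivative.

(** * Continuous families of smooth functions *)

Section JointContinuity.
Context {R : realType} {X : topologicalType}.
Local Notation I := (I01 R).

Definition jcont {T : topologicalType} (f : X -> I -> T) : Prop :=
  continuous (fun p : I * X => f p.2 p.1).

Lemma jcont_slice (T : topologicalType) (f : X -> I -> T) x :
  jcont f -> continuous (f x).
Proof.
move=> fc t.
have cp : {for t, continuous (fun s : I => (s, x))}.
  move=> P [[A B] /= [At Bx] AB]; apply: filterS At => s As.
  by apply: AB; split=> //=; exact: nbhs_singleton.
exact: (continuous_comp cp (fc (t, x))).
Qed.

Lemma jcont_cst (T : topologicalType) (u : I -> T) :
  continuous u -> jcont (fun _ : X => u).
Proof. by move=> uc p; apply: continuous_comp; [exact: cvg_fst|exact: uc]. Qed.

(** Compactness of [0,1] merges the neighbourhoods given by joint continuity at each (t, x0) into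
    one neighbourhood of x0 valid for all t. Conversely, uniform closeness to [f x0] and continuity
    of [f x0] combine by the triangle inequality. *)
Lemma jcont_uniform (T : pseudoMetricType R) (f : X -> I -> T) :
  jcont f <-> (forall x, continuous (f x)) /\
              continuous (f : X -> {uniform I -> T}).
Proof.
split=> [fc|[fc fu]].
  split=> [x|x0]; first exact: jcont_slice.
  move=> P /uniform_nbhs[E [entE EP]].
  (* For [t'] near [t] and [x] near [x0], both [f x0 t'] and [f x t'] lie within e/2 of [f x0 t]. *)
  have cov t : [set: I] t -> \forall t' \near t & x \near x0, E (f x0 t', f x t').
    move=> _; rewrite -entourage_ballE in entE; case: entE => e /= e0 eE.
    have e2 : 0 < e / 2 by rewrite divr_gt0.
    have h1 := cvg_ball (fc (t, x0)) e2.
    have h2 := cvg_ball (@jcont_slice _ f x0 fc t) e2.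
    have h3 : \forall p \near (t, x0), ball (f x0 t) (e / 2) (f x0 p.1).
      exists ([set s | ball (f x0 t) (e / 2) (f x0 s)], setT); last by move=> [a b] [].
      by split; [exact: h2|exact: filterT].
    near=> p; apply: eE => /=; apply: (ball_splitr (z := f x0 t)).
      by near: p; exact: h3.
    by near: p; exact: h1.
  have /compact_near_coveringP nc := @I_compact R.
  have := nc X (nbhs x0) (fun x t => E (f x0 t, f x t)) (nbhs_filter x0) cov => h.
  suff : nbhs x0 (f @^-1` P) by [].
   apply: (@filterS _ _ (nbhs_filter x0)) h => x h.
  by apply: (EP (f x)) => t _; exact: h.
move=> [t0 x0]; apply/cvg_ballP => e e0.
have e2 : 0 < e / 2 by rewrite divr_gt0.
have h1 : \forall t \near t0, ball (f x0 t0) (e / 2) (f x0 t).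
  exact: (cvg_ball (fc x0 t0) e2).
have h2 : \forall x \near x0, forall t, ball (f x0 t) (e / 2) (f x t).
  have hU : nbhs (f x0 : {uniform I -> T})
      [set h | forall t, ball (f x0 t) (e / 2) (h t)].
    apply/uniform_nbhs; exists [set xy | ball xy.1 (e / 2) xy.2].
    split; last by move=> h hh t; exact: hh.
    by rewrite -entourage_ballE; exists (e / 2).
  exact: (fu x0 _ hU).
exists ([set t | ball (f x0 t0) (e / 2) (f x0 t)],
        [set x | forall t, ball (f x0 t) (e / 2) (f x t)]) => //=.
by move=> [t x] /= [ht hx]; apply: ball_split ht (hx t).
Unshelve. all: by end_near. Qed.

End JointContinuity.

Section Regularity.
Context {R : realType} {X : topologicalType}.
Local Notation I := (I01 R).
Implicit Types f g : X -> I -> R.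

(* By [jcont_uniform], continuity of [x |-> f x] for the C^k topology. *)
Fixpoint CK (k : nat) f : Prop := jcont f /\
  if k is k'.+1 then
    exists2 f', (forall x t, isder (f x) t (f' x t)) & CK k' f'
  else True.

Lemma CK_jcont k f : CK k f -> jcont f.
Proof. by case: k => [|k] []. Qed.

Lemma CKW k f : CK k.+1 f -> CK k f.
Proof.
elim: k f => [|k IH] f [fc [f' ff' f'k]]; split => //.
by exists f' => //; exact: IH.
Qed.

Lemma CK_cst k (a : R) : CK k (fun _ _ => a).
Proof.
elim: k a => [|k IH] a; split => //; try by move=> p; exact: cvg_cst.
by exists (fun _ _ => 0) => // x t; exact: isder_cst.
Qed.

Lemma CKD k f g : CK k f -> CK k g -> CK k (fun x t => f x t + g x t).
Proof.
elim: k f g => [|k IH] f g [fc fd] [gc gd]; split => //;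
  try by move=> p; apply: cvgD; [exact: fc|exact: gc].
have [f' ff' f'k] := fd; have [g' gg' g'k] := gd.
exists (fun x t => f' x t + g' x t); last exact: IH.
by move=> x t; apply: isderD.
Qed.

Lemma CKN k f : CK k f -> CK k (fun x t => - f x t).
Proof.
elim: k f => [|k IH] f [fc fd]; split => //;
  try by move=> p; apply: cvgN; exact: fc.
have [f' ff' f'k] := fd; exists (fun x t => - f' x t); last exact: IH.
by move=> x t; apply: isderN.
Qed.

Lemma CKM k f g : CK k f -> CK k g -> CK k (fun x t => f x t * g x t).
Proof.
elim: k f g => [|k IH] f g fk gk.
  by split=> // p; apply: cvgM; [exact: (CK_jcont fk)|exact: (CK_jcont gk)].
split; first by move=> p; apply: cvgM; [exact: (CK_jcont fk)|exact: (CK_jcont gk)].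
have [_ [f' ff' f'k]] := fk; have [_ [g' gg' g'k]] := gk.
exists (fun x t => f' x t * g x t + f x t * g' x t).
  by move=> x t; apply: isderM.
by apply: CKD; apply: IH => //; exact: CKW.
Qed.

(** The derivative of the inverse contains the inverse itself, whose regularity of order k is the
    induction hypothesis; [CK_sqrt] follows the same scheme. *)
Lemma CKV k f : (forall x t, f x t != 0) -> CK k f ->
  CK k (fun x t => (f x t)^-1).
Proof.
move=> f0; elim: k => [|k IH] fk.
  by split => // p; apply: cvgV => //; exact: (CK_jcont fk).
split; first by move=> p; apply: cvgV => //; exact: (CK_jcont fk).
have [_ [f' ff' f'k]] := fk; have fVk := IH (CKW fk).
exists (fun x t => - (f' x t * ((f x t)^-1 * (f x t)^-1))).
  by move=> x t; apply: isderV.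
by apply: CKN; apply: CKM => //; apply: CKM.
Qed.

Lemma CK_sqrt k f : (forall x t, 0 < f x t) -> CK k f ->
  CK k (fun x t => Num.sqrt (f x t)).
Proof.
move=> f0; have sc : jcont f -> jcont (fun x t => Num.sqrt (f x t)).
  by move=> fc p; apply: continuous_cvg; [exact: sqrt_continuous|exact: fc].
elim: k => [|k IH] fk; first by split => //; apply/sc/CK_jcont/fk.
split; first by apply/sc/CK_jcont/fk.
have [_ [f' ff' f'k]] := fk; have fSk := IH (CKW fk).
exists (fun x t => f' x t * (Num.sqrt (f x t) + Num.sqrt (f x t))^-1).
  by move=> x t; apply: isder_sqrt.
apply: CKM => //; apply: CKV; last exact: CKD.
by move=> x t; rewrite gt_eqF // addr_gt0 // sqrtr_gt0.
Qed.

Lemma vder_continuous m (g : I -> 'cV[R]_m.+1) :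
  (forall t, exists l, vder g t l) -> continuous g.
Proof.
move=> gd t; apply/(@cvg_colP _ _ _ (nbhs_filter t)) => i; move: t.
apply: isder_continuous => t; have [l gl] := gd t.
by exists (l i 0); exact: gl.
Qed.

Definition VK {m} k (g : X -> I -> 'cV[R]_m) : Prop :=
  forall i, CK k (fun x t => g x t i 0).

(** [cderiv] is a [lim], meaningful only if the limit exists: the derivatives supplied by [CK] give
    existence, and uniqueness of limits identifies them with the coordinates of [cderiv]. *)
Lemma VK_cderiv m k (g : X -> I -> 'cV[R]_m.+1) : VK k.+1 g ->
  (forall x t, vder (g x) t (cderiv (g x) t)) /\ VK k (fun x => cderiv (g x)).
Proof.
move=> gk.
have /choice[g' gg'] : forall i, exists g'i : X -> I -> R,
    (forall x t, isder (fun s => g x s i 0) t (g'i x t)) /\ CK k g'i.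
  by move=> i; have [_ [g'i]] := gk i; exists g'i.
have gd x t : vder (g x) t (cderiv (g x) t).
  apply: (@vder_cderiv _ _ _ _ (\col_i g' i x t)) => i; rewrite mxE.
  by have [+ _] := gg' i; apply.
split => // i; have [gi] := gg' i.
congr (CK k _); apply/funext => x; apply/funext => t.
exact: isder_unique (gi x t) (gd x t i).
Qed.

Lemma VK_cderivn m i k (g : X -> I -> 'cV[R]_m.+1) :
  VK (i + k) g -> VK k (fun x => cderivn i (g x)).
Proof.
elim: i k => [//|i IH] k; rewrite addSnnS => /IH gk.
by have [_] := VK_cderiv gk.
Qed.

Lemma VK_le m i k (g : X -> I -> 'cV[R]_m) : (i <= k)%N -> VK k g -> VK i g.
Proof.
move=> /subnK <-; elim: (k - i)%N => [//|j IH] gk; apply: IH => l.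
exact/CKW/gk.
Qed.

Lemma VK_smooth m (g : X -> I -> 'cV[R]_m.+1) x :
  (forall k, VK k g) -> smooth (g x).
Proof.
move=> gk k t; have gk1 : VK (k + 1) g by [].
have [gd _] := VK_cderiv (VK_cderivn gk1).
by apply/cvg_ex; exists (cderivn k.+1 (g x) t); apply/vderP.
Qed.

Lemma jcont_coord m (g : X -> I -> 'cV[R]_m.+1) :
  jcont g <-> forall i, jcont (fun x t => g x t i 0).
Proof.
split=> [gc i p|gc p]; last by apply/cvg_colP => i; exact: gc.
by have /cvg_colP/(_ i) := gc p.
Qed.

Lemma VK_jcont m k (g : X -> I -> 'cV[R]_m.+1) : VK k g -> jcont g.
Proof. by move=> gk; apply/jcont_coord => i; exact: CK_jcont (gk i). Qed.

Lemma jcont_VK0 m (g : X -> I -> 'cV[R]_m.+1) : jcont g -> VK 0 g.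
Proof. by move=> gc i; split=> //; exact: (jcont_coord _).1. Qed.

Lemma VKS m k (g g' : X -> I -> 'cV[R]_m.+1) : jcont g ->
  (forall x t, vder (g x) t (g' x t)) -> VK k g' -> VK k.+1 g.
Proof.
move=> gc gg' g'k i; split; first by have /jcont_coord := gc.
by exists (fun x t => g' x t i 0) => // x t; exact: gg'.
Qed.

End Regularity.

(** * Topologies on spaces of curves in terms of families *)

Section SmoothCurves.
Context {R : realType} {X : topologicalType}.
Local Notation I := (I01 R).

(** Composing with a projection of [jet] shows that each derivative of order in K varies
    continuously for uniform convergence, hence is jointly continuous by [jcont_uniform]. *)
Lemma smooth_curve_VK (K : set nat) n k (h : X -> smooth_curve R K n) :
  (forall i, (i <= k)%N -> K i) -> continuous h ->
  VK k (fun x => val (h x) : I -> 'cV[R]_n.+1).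
Proof.
move=> Kk hc.
have sm x : smooth (val (h x)) by have := valP (h x); rewrite inE.
have jc i : K i -> jcont (fun x => cderivn i (val (h x) : I -> 'cV[R]_n.+1)).
  move=> Ki; apply/jcont_uniform; split=> [x|x].
    by apply: vder_continuous => t; exists (cderivn i.+1 (val (h x)) t); exact: smooth_vder.
  pose Ji : smooth_curve R K n -> {uniform I -> 'cV[R]_n.+1} :=
    proj (exist _ i (mem_set Ki)) \o @jet R K n.
  have Jc : continuous Ji.
    move=> g; apply: continuous_comp; first exact: initial_continuous.
    exact: proj_continuous.
  exact: (continuous_comp (hc x) (Jc (h x))).
(* Induction on the number j of orders still available, for every starting order i. *)
suff H i j : (i + j <= k)%N -> VK j (fun x => cderivn i (val (h x) : I -> 'cV[R]_n.+1)).
  exact: (H 0%N k).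
elim: j i => [|j IH] i ijk.
  by apply/jcont_VK0/jc/Kk; rewrite addn0 in ijk.
apply: (VKS (g' := fun x => cderivn i.+1 (val (h x)))).
- by apply/jc/Kk; rewrite (leq_trans _ ijk) ?leq_addr.
- by move=> x t; exact: smooth_vder.
- by apply: IH; rewrite addSnnS.
Qed.

Lemma smooth_curve_continuous (K : set nat) n (h : X -> smooth_curve R K n) :
  (forall i, K i -> VK i (fun x => val (h x) : I -> 'cV[R]_n.+1)) -> continuous h.
Proof.
move=> hk; apply: (@continuous_comp_initial _ _ _ (@jet R K n) h) => x.
apply/cvg_sup => i; move: x.
apply: (@continuous_comp_initial _ _ _
  (fun f : prod_topology (fun _ : K => {uniform I -> 'cV[R]_n.+1}) => f i)
  (@jet R K n \o h)) => x.
have Ki : K (val i) by have := valP i; rewrite inE.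
have := hk _ Ki; rewrite -[X in VK X]addn0 => /VK_cderivn/VK_jcont/jcont_uniform[_].
exact.
Qed.

End SmoothCurves.

(** * Quaternions and rotations *)

Section Euclid.
Context {R : realType} {m : nat}.
Implicit Types u v w : 'cV[R]_m.

Lemma dotC u v : dot u v = dot v u.
Proof. by apply: eq_bigr => i _; rewrite mulrC. Qed.

Lemma dotDl u v w : dot (u + v) w = dot u w + dot v w.
Proof. by rewrite -big_split; apply: eq_bigr => i _; rewrite mxE mulrDl. Qed.

Lemma dotZl a u v : dot (a *: u) v = a * dot u v.
Proof. by rewrite mulr_sumr; apply: eq_bigr => i _; rewrite mxE mulrA. Qed.

Lemma dotDr u v w : dot w (u + v) = dot w u + dot w v.
Proof. by rewrite dotC dotDl !(dotC w). Qed.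

Lemma dotZr a u v : dot u (a *: v) = a * dot u v.
Proof. by rewrite dotC dotZl (dotC v). Qed.

Lemma dotNl u v : dot (- u) v = - dot u v.
Proof. by rewrite -scaleN1r dotZl mulN1r. Qed.

Lemma dotNr u v : dot u (- v) = - dot u v.
Proof. by rewrite dotC dotNl dotC. Qed.

Lemma dot0l v : dot 0 v = 0.
Proof. by rewrite -(scale0r v) dotZl mul0r. Qed.

Lemma dot_suml I r (P : pred I) (F : I -> 'cV[R]_m) v :
  dot (\sum_(i <- r | P i) F i) v = \sum_(i <- r | P i) dot (F i) v.
Proof.
by elim/big_rec2: _ => [|i x y _ <-]; [exact: dot0l|exact: dotDl].
Qed.

Lemma dot_ge0 u : 0 <= dot u u.
Proof. by apply: sumr_ge0 => i _; rewrite -expr2 sqr_ge0. Qed.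

Lemma dot_eq0 u : (dot u u == 0) = (u == 0).
Proof.
apply/eqP/eqP => [|->]; last exact: dot0l.
move=> /eqP; rewrite psumr_eq0 => [/allP u0|i _]; last by rewrite -expr2 sqr_ge0.
apply/colP => i; rewrite mxE; apply/eqP.
by have := u0 i (mem_index_enum _); rewrite mulf_eq0 orbb.
Qed.

Lemma dot_gt0 u : (0 < dot u u) = (u != 0).
Proof. by rewrite lt_def dot_ge0 andbT dot_eq0. Qed.

Lemma enorm_sqr u : enorm u ^+ 2 = dot u u.
Proof. by rewrite sqr_sqrtr // dot_ge0. Qed.

Lemma enorm_gt0 u : (0 < enorm u) = (u != 0).
Proof. by rewrite sqrtr_gt0 dot_gt0. Qed.

Lemma enorm1P u : enorm u = 1 <-> dot u u = 1.
Proof.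
by rewrite /enorm; split=> [u1|->]; rewrite ?sqrtr1 // -enorm_sqr /enorm u1 expr1n.
Qed.

Lemma enormZ a u : 0 <= a -> enorm (a *: u) = a * enorm u.
Proof.
move=> a0; rewrite /enorm dotZl dotZr mulrA -expr2.
by rewrite sqrtrM ?sqr_ge0 // sqrtr_sqr ger0_norm.
Qed.

Lemma coordD u v i : (u + v) i 0 = u i 0 + v i 0.
Proof. by rewrite mxE. Qed.

Lemma coordZ a u i : (a *: u) i 0 = a * u i 0.
Proof. by rewrite mxE. Qed.

Lemma mulmx_trE (M N : 'M[R]_m) i j : (M^T *m N) i j = dot (col i M) (col j N).
Proof. by rewrite !mxE; apply: eq_bigr => k _; rewrite !mxE. Qed.

End Euclid.

Section QuaternionAlgebra.
Context {R : realType}.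
Local Notation quat := (@quat R).
Implicit Types p q r z : 'cV[R]_4.

Lemma quat_eta q :
  q = quat (q (inord 0) 0) (q (inord 1) 0) (q (inord 2) 0) (q (inord 3) 0).
Proof.
apply/colP => -[[|[|[|[|//]]]] i4]; rewrite mxE /=;
  by congr (q _ 0); apply: val_inj; rewrite /= inordK.
Qed.

Lemma quat_surj q : exists a b c d, q = quat a b c d.
Proof. by do 4 eexists; exact: quat_eta. Qed.

Lemma quat_coord a b c d :
  (quat a b c d (inord 0) 0 = a) * (quat a b c d (inord 1) 0 = b) *
  (quat a b c d (inord 2) 0 = c) * (quat a b c d (inord 3) 0 = d).
Proof. by split; [split; [split|]|]; rewrite mxE inordK. Qed.

Lemma qmul_quat a b c d a' b' c' d' :
  qmul (quat a b c d) (quat a' b' c' d') =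
  quat (a * a' - b * b' - c * c' - d * d') (a * b' + b * a' + c * d' - d * c')
       (a * c' - b * d' + c * a' + d * b') (a * d' + b * c' - c * b' + d * a').
Proof. by rewrite /qmul !quat_coord. Qed.

Lemma qconj_quat a b c d : qconj (quat a b c d) = quat a (- b) (- c) (- d).
Proof. by rewrite /qconj !quat_coord. Qed.

Lemma quatD a b c d a' b' c' d' : quat a b c d + quat a' b' c' d' =
  quat (a + a') (b + b') (c + c') (d + d').
Proof. by apply/colP => -[[|[|[|[|//]]]] i4]; rewrite !mxE. Qed.

Lemma quatZ x a b c d : x *: quat a b c d = quat (x * a) (x * b) (x * c) (x * d).
Proof. by apply/colP => -[[|[|[|[|//]]]] i4]; rewrite !mxE. Qed.

Lemma quatN a b c d : - quat a b c d = quat (- a) (- b) (- c) (- d).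
Proof. by apply/colP => -[[|[|[|[|//]]]] i4]; rewrite !mxE. Qed.

Lemma dot_quat a b c d a' b' c' d' :
  dot (quat a b c d) (quat a' b' c' d') = a * a' + b * b' + c * c' + d * d'.
Proof. by rewrite /dot !big_ord_recl big_ord0 !mxE /= addr0 !addrA. Qed.

Local Definition quatE :=
  (qmul_quat, qconj_quat, quatD, quatZ, quatN, dot_quat).

Ltac quat_split q :=
  let a := fresh in let b := fresh in let c := fresh in let d := fresh in
  have [a [b [c [d ->]]]] := quat_surj q.

Lemma qmulA p q r : qmul p (qmul q r) = qmul (qmul p q) r.
Proof.
by quat_split p; quat_split q; quat_split r; rewrite !quatE; congr Defs.quat; ring.
Qed.

Lemma qmulDl p q r : qmul (p + q) r = qmul p r + qmul q r.
Proof.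
by quat_split p; quat_split q; quat_split r; rewrite !quatE; congr Defs.quat; ring.
Qed.

Lemma qmulDr p q r : qmul r (p + q) = qmul r p + qmul r q.
Proof.
by quat_split p; quat_split q; quat_split r; rewrite !quatE; congr Defs.quat; ring.
Qed.

Lemma qmulZl x p q : qmul (x *: p) q = x *: qmul p q.
Proof. by quat_split p; quat_split q; rewrite !quatE; congr Defs.quat; ring. Qed.

Lemma qmulZr x p q : qmul p (x *: q) = x *: qmul p q.
Proof. by quat_split p; quat_split q; rewrite !quatE; congr Defs.quat; ring. Qed.

Lemma qmulNl p q : qmul (- p) q = - qmul p q.
Proof. by rewrite -scaleN1r qmulZl scaleN1r. Qed.

Lemma qmulNr p q : qmul p (- q) = - qmul p q.
Proof. by rewrite -scaleN1r qmulZr scaleN1r. Qed.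

Lemma qmul_suml J (r : seq J) (F : J -> 'cV[R]_4) q :
  qmul (\sum_(i <- r) F i) q = \sum_(i <- r) qmul (F i) q.
Proof.
elim/big_rec2: _ => [|i x y _ <-]; last exact: qmulDl.
by have := qmulZl 0 0 q; rewrite !scale0r.
Qed.

Lemma qmul_sumr J (r : seq J) (F : J -> 'cV[R]_4) q :
  qmul q (\sum_(i <- r) F i) = \sum_(i <- r) qmul q (F i).
Proof.
elim/big_rec2: _ => [|i x y _ <-]; last exact: qmulDr.
by have := qmulZr 0 q 0; rewrite !scale0r.
Qed.

Lemma qmulq0 q : qmul q 0 = 0.
Proof. by have := qmulZr 0 q 0; rewrite !scale0r. Qed.

(** Bilinearity with constant structure coefficients: differentiation and regularity of quaternion
    products reduce to sums and products of scalars. *)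
Lemma qmul_coord p q l : qmul p q l 0 =
  \sum_i \sum_j p i 0 * q j 0 * qmul (delta_mx i 0) (delta_mx j 0) l 0.
Proof.
rewrite [in LHS](matrix_sum_delta p) qmul_suml summxE; apply: eq_bigr => i _.
rewrite big_ord1 [in LHS](matrix_sum_delta q) qmul_sumr summxE.
by apply: eq_bigr => j _; rewrite big_ord1 qmulZl qmulZr scalerA coordZ.
Qed.

Lemma qmul1 p : qmul qone p = p.
Proof. by quat_split p; rewrite !quatE; congr Defs.quat; ring. Qed.

Lemma qmulq1 p : qmul p qone = p.
Proof. by quat_split p; rewrite !quatE; congr Defs.quat; ring. Qed.

Lemma qconjM p q : qconj (qmul p q) = qmul (qconj q) (qconj p).
Proof. by quat_split p; quat_split q; rewrite !quatE; congr Defs.quat; ring. Qed.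

Lemma qconjK p : qconj (qconj p) = p.
Proof. by quat_split p; rewrite !quatE; congr Defs.quat; ring. Qed.

Lemma qconjZ x p : qconj (x *: p) = x *: qconj p.
Proof. by quat_split p; rewrite !quatE; congr Defs.quat; ring. Qed.

Lemma qconj1 : qconj qone = qone :> 'cV[R]_4.
Proof. by rewrite !quatE; congr Defs.quat; ring. Qed.

Lemma qmulC_conj p : qmul p (qconj p) = dot p p *: qone.
Proof. by quat_split p; rewrite !quatE; congr Defs.quat; ring. Qed.

Lemma qmul_conjC p : qmul (qconj p) p = dot p p *: qone.
Proof. by quat_split p; rewrite !quatE; congr Defs.quat; ring. Qed.

Lemma dot_qmull p q r : dot (qmul p q) (qmul p r) = dot p p * dot q r.
Proof. by quat_split p; quat_split q; quat_split r; rewrite !quatE; ring. Qed.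

Lemma dot_qmulr p q r : dot (qmul q p) (qmul r p) = dot p p * dot q r.
Proof. by quat_split p; quat_split q; quat_split r; rewrite !quatE; ring. Qed.

Lemma dot_qconj p q : dot (qconj p) (qconj q) = dot p q.
Proof. by quat_split p; quat_split q; rewrite !quatE; ring. Qed.

Lemma unit_quatP (z : 'cV[R]_4) : unit_quat z <-> dot z z = 1.
Proof. exact: enorm1P. Qed.

Lemma unit_qmulV z : unit_quat z -> qmul z (qconj z) = qone.
Proof. by move=> /unit_quatP z1; rewrite qmulC_conj z1 scale1r. Qed.

Lemma unit_qmulVl z : unit_quat z -> qmul (qconj z) z = qone.
Proof. by move=> /unit_quatP z1; rewrite qmul_conjC z1 scale1r. Qed.

Definition qi : 'cV[R]_4 := quat 0 1 0 0.
Definition qj : 'cV[R]_4 := quat 0 0 1 0.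
Definition qk : 'cV[R]_4 := quat 0 0 0 1.

Definition im3 q : 'cV[R]_3 := \col_i q (lift ord0 i) 0.

Lemma im3E q i : im3 q i 0 = q (lift ord0 i) 0.
Proof. by rewrite mxE. Qed.

Lemma im3_imq h : im3 (imq h) = h :> 'cV[R]_3.
Proof.
apply/colP => -[[|[|[|//]]] i3]; rewrite !mxE /=;
  by congr (h _ 0); apply: val_inj; rewrite /= inordK.
Qed.

Lemma imq_im3 q : q ord0 0 = 0 -> imq (im3 q) = q.
Proof.
move=> q0; rewrite [RHS]quat_eta /imq !mxE; congr Defs.quat.
- by rewrite -q0; congr (q _ 0); apply: val_inj; rewrite /= inordK.
- by congr (q _ 0); apply: val_inj; rewrite /= !inordK.
- by congr (q _ 0); apply: val_inj; rewrite /= !inordK.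
- by congr (q _ 0); apply: val_inj; rewrite /= !inordK.
Qed.

Lemma dot_imq (h h' : 'cV[R]_3) : dot (imq h) (imq h') = dot h h'.
Proof.
by rewrite -[in RHS](im3_imq h) -[in RHS](im3_imq h') /dot big_ord_recl !mxE /= mul0r add0r;
  apply: eq_bigr => i _; rewrite !mxE.
Qed.

Lemma im3D p q : im3 (p + q) = im3 p + im3 q.
Proof. by apply/colP => i; rewrite !mxE. Qed.

Lemma im3Z a p : im3 (a *: p) = a *: im3 p.
Proof. by apply/colP => i; rewrite !mxE. Qed.

Lemma qmul_basis : (qmul qi qj = qk) * (qmul qj qk = qi) * (qmul qk qi = qj) *
  (qmul qj qi = - qk) * (qmul qk qj = - qi) * (qmul qi qk = - qj) *
  (qmul qi qi = - qone) * (qmul qj qj = - qone) * (qmul qk qk = - qone) *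
  (qconj qi = - qi) * (qconj qj = - qj) * (qconj qk = - qk).
Proof.
by do ![split]; rewrite /qi /qj /qk /qone ?qmul_quat ?qconj_quat ?quatN; congr Defs.quat; ring.
Qed.

Lemma dot_basis :
  (dot (qone : 'cV[R]_4) qone = 1) * (dot qi qi = 1) * (dot qj qj = 1) *
  (dot qk qk = 1) * (dot (qone : 'cV[R]_4) qi = 0) *
  (dot (qone : 'cV[R]_4) qj = 0) * (dot (qone : 'cV[R]_4) qk = 0) *
  (dot qi (qone : 'cV[R]_4) = 0) * (dot qi qj = 0) * (dot qi qk = 0) *
  (dot qj (qone : 'cV[R]_4) = 0) * (dot qj qi = 0) * (dot qj qk = 0) *
  (dot qk (qone : 'cV[R]_4) = 0) * (dot qk qi = 0) * (dot qk qj = 0).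
Proof. by do ![split]; rewrite /qi /qj /qk /qone dot_quat; ring. Qed.

Lemma basis_real : (qi ord0 0 = 0) * (qj ord0 0 = 0) * (qk ord0 0 = 0).
Proof. by do ![split]; rewrite mxE. Qed.

Lemma imqZ a (h : 'cV[R]_3) : imq (a *: h) = a *: imq h.
Proof. by rewrite /imq quatZ mulr0 !coordZ. Qed.

(** Conjugation therefore preserves imaginary quaternions, so that passing between R^3 and R^4 loses
    nothing. *)
Lemma conj_real z q : (qmul (qmul z q) (qconj z)) ord0 0 = dot z z * q ord0 0.
Proof. by quat_split z; quat_split q; rewrite !quatE !mxE /=; ring. Qed.

Lemma delta_quat (j : 'I_4) :
  delta_mx j 0 = [:: qone; qi; qj; qk]`_j :> 'cV[R]_4.
Proof.
by case: j => -[|[|[|[|//]]]] j4; apply/colP => -[[|[|[|[|//]]]] i4]; rewrite !mxE.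
Qed.

Lemma imq_delta (j : 'I_3) : imq (delta_mx j 0) = [:: qi; qj; qk]`_j :> 'cV[R]_4.
Proof.
by case: j => -[|[|[|//]]] j4; rewrite /imq !mxE -!val_eqE /= !inordK.
Qed.

Lemma Pi4E zl zr (v : 'cV[R]_4) : Pi4 zl zr *m v = qmul (qmul zl v) (qconj zr).
Proof.
rewrite [in RHS](matrix_sum_delta v); under [in RHS]eq_bigr do rewrite big_ord1.
rewrite !big_ord_recl !big_ord0 !addr0 !(qmulDl, qmulDr, qmulZl, qmulZr).
apply/colP => i; rewrite !(coordD, coordZ) mxE.
under eq_bigr do rewrite mxE mulrC.
by rewrite !big_ord_recl big_ord0 addr0.
Qed.

Lemma Pi3E z (h : 'cV[R]_3) : Pi3 z *m h = im3 (qmul (qmul z (imq h)) (qconj z)).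
Proof.
have -> : imq h = \sum_j h j 0 *: imq (delta_mx j 0).
  rewrite !big_ord_recl big_ord0 addr0 !imq_delta /= !quatE /imq.
  by congr Defs.quat; rewrite ?mulr0 ?mulr1 ?addr0 ?add0r //;
    congr (h _ 0); apply: val_inj; rewrite /= inordK.
rewrite !big_ord_recl !big_ord0 !addr0 !(qmulDl, qmulDr, qmulZl, qmulZr, im3D, im3Z).
apply/colP => i; rewrite !(coordD, coordZ) mxE.
under eq_bigr do rewrite mxE mulrC.
by rewrite !big_ord_recl big_ord0 addr0 !im3E.
Qed.

Lemma col_Pi4 zl zr j :
  col j (Pi4 zl zr) = qmul (qmul zl ([:: qone; qi; qj; qk]`_j)) (qconj zr).
Proof. by rewrite -delta_quat -Pi4E colE. Qed.

Lemma col_Pi3 z j : col j (Pi3 z) = im3 (qmul (qmul z ([:: qi; qj; qk]`_j)) (qconj z)).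
Proof. by rewrite -imq_delta -Pi3E colE. Qed.

Lemma cVmulP (m : nat) (M N : 'M[R]_m) : (forall v : 'cV_m, M *m v = N *m v) -> M = N.
Proof.
move=> h; apply/matrixP => i j; have := h (delta_mx j 0).
by rewrite -!colE => /colP/(_ i); rewrite !mxE.
Qed.

Lemma Pi4M p p' q q' : Pi4 (qmul p q) (qmul p' q') = Pi4 p p' *m Pi4 q q'.
Proof. by apply: cVmulP => v; rewrite -mulmxA !Pi4E qconjM !qmulA. Qed.

Lemma imq_conj z q : q ord0 0 = 0 ->
  imq (im3 (qmul (qmul z q) (qconj z))) = qmul (qmul z q) (qconj z).
Proof. by move=> q0; rewrite imq_im3 // conj_real q0 mulr0. Qed.

Lemma imq_real (h : 'cV[R]_3) : imq h ord0 0 = 0.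
Proof. by rewrite mxE. Qed.

Lemma Pi3M p q : Pi3 (qmul p q) = Pi3 p *m Pi3 q.
Proof.
apply: cVmulP => v; rewrite -mulmxA !Pi3E imq_conj ?imq_real //.
by rewrite qconjM !qmulA.
Qed.

Lemma Pi4_1 : Pi4 qone qone = 1%:M :> 'M[R]_4.
Proof. by apply: cVmulP => v; rewrite Pi4E mul1mx qmul1 qconj1 qmulq1. Qed.

Lemma Pi3_1 : Pi3 qone = 1%:M :> 'M[R]_3.
Proof. by apply: cVmulP => v; rewrite Pi3E mul1mx qmul1 qconj1 qmulq1 im3_imq. Qed.

Lemma Pi4_orth (zl zr : 'cV[R]_4) : unit_quat zl -> unit_quat zr ->
  (Pi4 zl zr)^T *m Pi4 zl zr = 1%:M.
Proof.
move=> /unit_quatP ul /unit_quatP ur; apply/matrixP => i j.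
rewrite mulmx_trE !colE !Pi4E dot_qmulr dot_qconj ur mul1r dot_qmull ul mul1r.
rewrite /dot (bigD1 j) //= big1 => [|k kj]; last by rewrite !mxE (negPf kj) mulr0.
by rewrite !mxE !eqxx andbT addr0 mulr1 eq_sym.
Qed.

Lemma Pi3_orth (z : 'cV[R]_4) : unit_quat z -> (Pi3 z)^T *m Pi3 z = 1%:M.
Proof.
move=> /unit_quatP u; apply/matrixP => i j.
rewrite mulmx_trE !colE !Pi3E -dot_imq !imq_conj ?imq_real //.
rewrite dot_qmulr dot_qconj u mul1r dot_qmull u mul1r dot_imq.
rewrite /dot (bigD1 j) //= big1 => [|k kj]; last by rewrite !mxE (negPf kj) mulr0.
by rewrite !mxE !eqxx andbT addr0 mulr1 eq_sym.
Qed.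

(* Since unit quaternions have square roots, [Pi3 z] and [Pi4 zl zr] are squares of
   orthogonal matrices, hence have determinant 1. *)
Lemma unit_quat_sqrt (z : 'cV[R]_4) : unit_quat z -> exists2 w, unit_quat w & z = qmul w w.
Proof.
move=> uz; have [->|z1] := eqVneq z (- qone).
  by exists qi; [apply/unit_quatP|]; rewrite !quatE; [|congr Defs.quat]; ring.
(* For unit z one has (1 + z)^2 = |1 + z|^2 z, so 1 + z normalized is a root; only z = -1, treated
   above with the root i, escapes. *)
pose s := enorm (qone + z); have s0 : 0 < s.
  by rewrite enorm_gt0 addrC addr_eq0.
exists (s^-1 *: (qone + z)).
  by apply/unit_quatP; rewrite dotZl dotZr -enorm_sqr -/s; field; rewrite gt_eqF.
move/unit_quatP: uz => uz.
rewrite qmulZl qmulZr scalerA -invfM -expr2 enorm_sqr.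
have d0 : dot (qone + z) (qone + z) != 0 by rewrite dot_eq0 addrC addr_eq0.
apply: (scalerI d0); rewrite [RHS]scalerA mulfV // scale1r {d0}.
clear s s0 z1.
move: uz; have [a [b [c [d ->]]]] := quat_surj z; rewrite !quatE => uz.
have {}uz : a * a = 1 - b * b - c * c - d * d by rewrite -uz; ring.
by congr Defs.quat; ring: uz.
Qed.

Lemma det_orth_sqr n (M : 'M[R]_n) : M^T *m M = 1%:M -> \det M * \det M = 1.
Proof. by move=> /(congr1 determinant); rewrite det_mulmx det_tr det1. Qed.

Lemma Pi4_SO (zl zr : 'cV[R]_4) : unit_quat zl -> unit_quat zr -> SO (Pi4 zl zr).
Proof.
move=> ul ur; split; first exact: Pi4_orth.
have [wl uwl ->] := unit_quat_sqrt ul; have [wr uwr ->] := unit_quat_sqrt ur.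
by rewrite Pi4M det_mulmx det_orth_sqr // Pi4_orth.
Qed.

Lemma Pi3_SO (z : 'cV[R]_4) : unit_quat z -> SO (Pi3 z).
Proof.
move=> u; split; first exact: Pi3_orth.
have [w uw ->] := unit_quat_sqrt u.
by rewrite Pi3M det_mulmx det_orth_sqr // Pi3_orth.
Qed.

End QuaternionAlgebra.

(** * Frenet frames *)

Section Frames.
Context {R : realType}.

Lemma gram_schmidt_rcons m (s : seq 'cV[R]_m) v :
  let w := v - \sum_(u <- gram_schmidt s) dot v u *: u in
  gram_schmidt (rcons s v) = rcons (gram_schmidt s) ((enorm w)^-1 *: w).
Proof. by rewrite /gram_schmidt foldl_rcons. Qed.

(** Uniqueness of the QR decomposition: subtracting the projections on the earlier [e j] leaves
    [c k *: e k], and positivity of [c k] makes its normalization [e k] and not its opposite. *)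
Lemma gram_schmidt_triangular m n (e D : nat -> 'cV[R]_m) (a : nat -> nat -> R)
    (c : nat -> R) :
  (forall i j, (i < n)%N -> (j < n)%N -> dot (e i) (e j) = (i == j)%:R) ->
  (forall k, (k < n)%N -> 0 < c k) ->
  (forall k, (k < n)%N -> D k = \sum_(j < k) a k j *: e j + c k *: e k) ->
  gram_schmidt [seq D k | k <- iota 0 n] = [seq e k | k <- iota 0 n].
Proof.
elim: n => [//|n IH] oe c0 De.
have -> : iota 0 n.+1 = rcons (iota 0 n) n by rewrite -addn1 iotaD cats1.
rewrite !map_rcons gram_schmidt_rcons.
rewrite IH; last 3 first.
- by move=> i j ilt jlt; apply: oe; exact: ltnW.
- by move=> k klt; apply: c0; exact: ltnW.
- by move=> k klt; apply: De; exact: ltnW.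
congr rcons; rewrite big_map.
have -> : iota 0 n = index_iota 0 n by rewrite /index_iota subn0.
rewrite big_mkord.
have ltS (j : 'I_n) : (j < n.+1)%N by rewrite ltnS ltnW.
have dotD (j : 'I_n) : dot (D n) (e j) = a n j.
  rewrite De // dotDl dotZl oe // (gtn_eqF (ltn_ord j)) mulr0 addr0.
  rewrite dot_suml (bigD1 j) //= dotZl oe // eqxx mulr1 big1 ?addr0 // => i ij.
  by rewrite dotZl oe // (inj_eq val_inj) (negPf ij) mulr0.
under eq_bigr do rewrite dotD.
rewrite De // addrC addrA [X in X + _]addNr add0r.
rewrite enormZ ?ltW ?c0 // (_ : enorm (e n) = 1); last by apply/enorm1P; rewrite oe ?eqxx.
by rewrite mulr1 scalerA mulVf ?scale1r // gt_eqF ?c0.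
Qed.

Lemma SO_orth n (M : 'M[R]_n) i j : SO M -> dot (col i M) (col j M) = (i == j)%:R.
Proof. by move=> [MM _]; rewrite -mulmx_trE MM mxE. Qed.

Lemma widen_lift n (i : 'I_n) : widen_ord (leqnSn n) i = lift ord_max i.
Proof. by apply: val_inj; rewrite /= /bump leqNgt ltn_ord. Qed.

(** The first n columns of P = M^T N are those of the identity; orthonormality of the columns of P
    kills the rest of the last column off the diagonal, and det P = 1 fixes the corner entry. *)
Lemma SO_eq_cols n (M N : 'M[R]_n.+1) : SO M -> SO N ->
  (forall i : 'I_n, col (widen_ord (leqnSn n) i) M = col (widen_ord (leqnSn n) i) N) ->
  M = N.
Proof.
move=> SM SN MN; have [MM dM] := SM; have [NN dN] := SN.
have MMt := mulmx1C MM.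
pose P := M^T *m N.
have PP : P^T *m P = 1%:M by rewrite trmx_mul trmxK -mulmxA (mulmxA M) MMt mul1mx.
have Pw i (j : 'I_n) : P i (lift ord_max j) = (i == lift ord_max j)%:R.
  by rewrite mulmx_trE -widen_lift -MN SO_orth.
have Pm (i : 'I_n) : P (lift ord_max i) ord_max = 0.
  have := congr1 (fun Q : 'M[R]_n.+1 => Q (lift ord_max i) ord_max) PP.
  rewrite /= [RHS]mxE eq_sym (negPf (neq_lift _ _)) mxE (bigD1 (lift ord_max i)) //=.
  rewrite big1 => [|k ki]; last by rewrite mxE Pw (negPf ki) mul0r.
  by rewrite addr0 mxE Pw eqxx mul1r.
have dP : \det P = P ord_max ord_max.
  rewrite det_trig; last first.
    apply/is_trig_mxP => i j ij; case: (unliftP ord_max j) ij => [j'|] -> ij.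
      by rewrite Pw; case: eqP ij => // ->; rewrite ltnn.
    case: (unliftP ord_max i) ij => [i'|] -> ij; first exact: Pm.
    by rewrite ltnn in ij.
  rewrite (bigD1 ord_max) //= big1 ?mulr1 // => i.
  by case: (unliftP ord_max i) => [i'|] ->; rewrite ?eqxx // Pw eqxx.
have P1 : P = 1%:M.
  apply/matrixP => i j; rewrite [RHS]mxE.
  case: (unliftP ord_max j) => [j'|] ->; first exact: Pw.
  case: (unliftP ord_max i) => [i'|] ->.
    by rewrite Pm eq_sym (negPf (neq_lift _ _)).
  by rewrite -dP det_mulmx det_tr dM dN mulr1 eqxx.
by rewrite -[N]mul1mx -MMt -mulmxA -/P P1 mulmx1.
Qed.

Definition frenet_set n (g : I01 R -> 'cV[R]_n.+1) (t : I01 R) : set 'M[R]_n.+1 :=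
  [set M | SO M /\ forall i : 'I_n, col (widen_ord (leqnSn n) i) M =
      (gram_schmidt [seq cderivn k g t | k <- iota 0 n])`_i].

(** The tool by which every frame below is computed: the same triangular shape yields the frame, by
    uniqueness of QR, and genericity. *)
Lemma frenet_triangular n (g : I01 R -> 'cV[R]_n.+1) t (M : 'M[R]_n.+1)
    (a : nat -> nat -> R) (c : nat -> R) :
  SO M -> (forall k, (k < n)%N -> 0 < c k) ->
  (forall k, (k < n)%N -> cderivn k g t =
     \sum_(j < k) a k j *: col (inord j) M + c k *: col (inord k) M) ->
  frenet g t = M /\ row_free (\matrix_(k < n) (cderivn k g t)^T).
Proof.
move=> SM c0 De.
have oe i j : (i < n)%N -> (j < n)%N ->
    dot (col (inord i) M) (col (inord j) M) = (i == j)%:R.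
  move=> iltn jltn; rewrite SO_orth // -(inj_eq val_inj) /= !inordK //; exact: ltnW.
split.
  have gsE := gram_schmidt_triangular oe c0 De.
  have FM : frenet_set g t M.
    split=> // i; rewrite gsE (nth_map 0%N) ?size_iota // nth_iota // add0n.
    by congr (col _ M); apply: val_inj; rewrite /= inordK // ltnW // ltnS.
  have [SF FE] : frenet_set g t (frenet g t) by apply: getPex; exists M.
  by apply: SO_eq_cols => // i; rewrite FE; case: FM => _ ->.
pose A := \matrix_(k < n) (cderivn k g t)^T.
(* Scalar products of the derivatives with the first n columns of M: a triangular matrix with
   diagonal [c], hence invertible, which forces A to have full rank. *)
pose T := A *m \matrix_(i < n.+1, j < n) M i (inord j).
have TE (k j : 'I_n) : T k j = dot (cderivn k g t) (col (inord j) M).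
  by rewrite mxE; apply: eq_bigr => l _; rewrite !mxE.
have Ttrig (k j : 'I_n) : (k <= j)%N -> T k j = (k == j)%:R * c k.
  move=> kj; rewrite TE De // dotDl dotZl oe // mulrC -[in RHS](inj_eq val_inj) /=.
  rewrite dot_suml big1 ?add0r // => i _.
  have ik := leq_trans (ltn_ord i) kj.
  by rewrite dotZl oe ?(ltn_trans ik) // (ltn_eqF ik) mulr0.
have Tu : T \in unitmx.
  rewrite unitmxE det_trig; last first.
    apply/is_trig_mxP => i j ij; rewrite Ttrig 1?ltnW //.
    by case: eqP ij => [->|]; rewrite ?ltnn // mul0r.
  rewrite unitfE; apply/prodf_neq0 => i _.
  by rewrite Ttrig // eqxx mul1r gt_eqF ?c0.
apply/eqP/anti_leq; rewrite rank_leq_row /=.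
have := mxrankM_maxl A (\matrix_(i < n.+1, j < n) M i (inord j)).
by rewrite -/T (mxrank_unit Tu).
Qed.

Lemma row_free_lincomb n m (D : 'I_n -> 'cV[R]_m) (c : 'I_n -> R) :
  row_free (\matrix_k (D k)^T) -> \sum_k c k *: D k = 0 -> forall k, c k = 0.
Proof.
move=> Df c0 k; have /row_free_inj/(_ (\row_i c i) 0) := Df.
rewrite /= mul0mx => e; have {}e : \row_i c i = 0.
  apply: e; apply/rowP => j; have := congr1 (fun v : 'cV[R]_m => v j 0) c0.
  rewrite summxE !mxE => cj; rewrite -[RHS]cj.
  by apply: eq_bigr => i _; rewrite !mxE.
by have := congr1 (fun v : 'rV[R]_n => v 0 k) e; rewrite !mxE.
Qed.

(* If no matrix satisfied the definition, [frenet g t] would be the default matrix,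
   which has equal columns and therefore is not in SO. *)
Lemma frenet_setP n (g : I01 R -> 'cV[R]_n.+2) t :
  SO (frenet g t) -> frenet_set g t (frenet g t).
Proof.
move=> SF; case: (pselect (exists M, frenet_set g t M)) => [|noM]; first exact: getPex.
have FE : frenet g t = point by apply: getPN => M FM; apply: noM; exists M.
have col0 : col 0 (frenet g t) = col 1 (frenet g t).
  by rewrite FE; apply/colP => i; rewrite !mxE.
have := SO_orth 0 1 SF; rewrite -col0 (SO_orth _ _ SF) eqxx => /eqP.
by rewrite oner_eq0.
Qed.

End Frames.

(** * Calculus and regularity for vector and quaternion valued curves *)

Section VectorCalculus.
Context {R : realType}.
Local Notation I := (I01 R).

Lemma isder_eq (f : I -> R) t a b : isder f t a -> a = b -> isder f t b.
Proof. by move=> fa <-. Qed.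

Lemma vder_eq m (f : I -> 'cV[R]_m) t a b : vder f t a -> a = b -> vder f t b.
Proof. by move=> fa <-. Qed.

Lemma isder_sum (J : Type) (r : seq J) (f : J -> I -> R) t (a : J -> R) :
  (forall i, isder (f i) t (a i)) ->
  isder (fun s => \sum_(i <- r) f i s) t (\sum_(i <- r) a i).
Proof.
move=> fa; elim: r => [|i r IH].
  by rewrite big_nil; under eq_fun do rewrite big_nil; exact: isder_cst.
by rewrite big_cons; under eq_fun do rewrite big_cons; exact: isderD.
Qed.

Lemma isder_dot m (p q : I -> 'cV[R]_m) t p' q' : vder p t p' -> vder q t q' ->
  isder (fun s => dot (p s) (q s)) t (dot p' (q t) + dot (p t) q').
Proof.
move=> hp hq; rewrite -big_split /=.
by apply: (@isder_sum _ _ (fun i s => p s i 0 * q s i 0)) => i; exact: isderM.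
Qed.

Lemma vderD m (p q : I -> 'cV[R]_m) t p' q' : vder p t p' -> vder q t q' ->
  vder (fun s => p s + q s) t (p' + q').
Proof.
move=> hp hq i; rewrite coordD; under eq_fun do rewrite coordD.
exact: isderD.
Qed.

Lemma vderZ m (a : I -> R) (p : I -> 'cV[R]_m) t a' p' : isder a t a' -> vder p t p' ->
  vder (fun s => a s *: p s) t (a' *: p t + a t *: p').
Proof.
move=> ha hp i; rewrite coordD !coordZ; under eq_fun do rewrite coordZ.
exact: isderM.
Qed.

Lemma vder_cst m (u : 'cV[R]_m) t : vder (fun=> u) t 0.
Proof. by move=> i; rewrite mxE; exact: isder_cst. Qed.

Lemma vder_quat (a b c d : I -> R) t a' b' c' d' :
  isder a t a' -> isder b t b' -> isder c t c' -> isder d t d' ->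
  vder (fun s => quat (a s) (b s) (c s) (d s)) t (quat a' b' c' d').
Proof.
by move=> ha hb hc hd -[[|[|[|[|//]]]] i4]; rewrite mxE /=; under eq_fun do rewrite mxE /=.
Qed.

Lemma vder_qmul (p q : I -> 'cV[R]_4) t p' q' : vder p t p' -> vder q t q' ->
  vder (fun s => qmul (p s) (q s)) t (qmul p' (q t) + qmul (p t) q').
Proof.
move=> hp hq l; rewrite coordD !qmul_coord -big_split /=.
under eq_fun do rewrite qmul_coord.
apply: (@isder_sum _ _ (fun i s => \sum_j p s i 0 * q s j 0 *
  qmul (delta_mx i 0) (delta_mx j 0) l 0)) => i.
rewrite -big_split /=; apply: (@isder_sum _ _ (fun j s => p s i 0 * q s j 0 *
  qmul (delta_mx i 0) (delta_mx j 0) l 0)) => j.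
apply: isder_eq (isderM (isderM (hp i) (hq j)) (isder_cst _ t)) _.
by rewrite mulr0 addr0 mulrDl.
Qed.

Lemma vder_qconj (p : I -> 'cV[R]_4) t p' : vder p t p' ->
  vder (fun s => qconj (p s)) t (qconj p').
Proof. by move=> hp; apply: vder_quat; [exact: hp|exact/isderN/hp..]. Qed.

Lemma vder_im3 (p : I -> 'cV[R]_4) t p' : vder p t p' ->
  vder (fun s => im3 (p s)) t (im3 p').
Proof. by move=> hp i; rewrite im3E; under eq_fun do rewrite im3E; exact: hp. Qed.

Lemma vder_imq (p : I -> 'cV[R]_3) t p' : vder p t p' ->
  vder (fun s => imq (p s)) t (imq p').
Proof. by move=> hp; apply: vder_quat; [exact: isder_cst|exact: hp..]. Qed.

Context {X : topologicalType}.

Lemma CK_sum k (J : Type) (r : seq J) (f : J -> X -> I -> R) :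
  (forall i, CK k (f i)) -> CK k (fun x s => \sum_(i <- r) f i x s).
Proof.
move=> fk; elim: r => [|i r IH].
  by under eq_fun do under eq_fun do rewrite big_nil; exact: CK_cst.
by under eq_fun do under eq_fun do rewrite big_cons; exact: CKD.
Qed.

Lemma CK_dot k m (p q : X -> I -> 'cV[R]_m) : VK k p -> VK k q ->
  CK k (fun x s => dot (p x s) (q x s)).
Proof. by move=> hp hq; apply: CK_sum => i; exact: CKM. Qed.

Lemma VKD k m (p q : X -> I -> 'cV[R]_m) : VK k p -> VK k q ->
  VK k (fun x s => p x s + q x s).
Proof.
move=> hp hq i; have := CKD (hp i) (hq i); congr CK.
by apply/funext => x; apply/funext => s; rewrite mxE.
Qed.

Lemma VKZ k m (a : X -> I -> R) (p : X -> I -> 'cV[R]_m) : CK k a -> VK k p ->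
  VK k (fun x s => a x s *: p x s).
Proof.
move=> ha hp i; have := CKM ha (hp i); congr CK.
by apply/funext => x; apply/funext => s; rewrite mxE.
Qed.

Lemma VKN k m (p : X -> I -> 'cV[R]_m) : VK k p -> VK k (fun x s => - p x s).
Proof.
move=> hp i; have := CKN (hp i); congr CK.
by apply/funext => x; apply/funext => s; rewrite mxE.
Qed.

Lemma VK_cst k m (u : 'cV[R]_m) : VK k (fun (_ : X) (_ : I) => u).
Proof. by move=> i; exact: CK_cst. Qed.

Lemma VK_quat k (a b c d : X -> I -> R) : CK k a -> CK k b -> CK k c -> CK k d ->
  VK k (fun x s => quat (a x s) (b x s) (c x s) (d x s)).
Proof.
move=> ha hb hc hd -[[|[|[|[|//]]]] i4]; [move: ha|move: hb|move: hc|move: hd];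
  by congr CK; apply/funext => x; apply/funext => s; rewrite mxE.
Qed.

Lemma VK_qmul k (p q : X -> I -> 'cV[R]_4) : VK k p -> VK k q ->
  VK k (fun x s => qmul (p x s) (q x s)).
Proof.
move=> hp hq l; under eq_fun do under eq_fun do rewrite qmul_coord.
apply: CK_sum => i; apply: CK_sum => j.
by apply: CKM (CK_cst _ _); exact: CKM.
Qed.

Lemma VK_qconj k (p : X -> I -> 'cV[R]_4) : VK k p -> VK k (fun x s => qconj (p x s)).
Proof. by move=> hp; apply: VK_quat; [exact: hp|exact/CKN/hp..]. Qed.

Lemma VK_im3 k (p : X -> I -> 'cV[R]_4) : VK k p -> VK k (fun x s => im3 (p x s)).
Proof.
move=> hp i; have := hp (lift ord0 i); congr CK.
by apply/funext => x; apply/funext => s; rewrite mxE.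
Qed.

Lemma VK_imq k (p : X -> I -> 'cV[R]_3) : VK k p -> VK k (fun x s => imq (p x s)).
Proof. by move=> hp; apply: VK_quat; [exact: CK_cst|exact: hp..]. Qed.

Lemma VK_normalize k m (p : X -> I -> 'cV[R]_m) : (forall x s, p x s != 0) -> VK k p ->
  VK k (fun x s => (enorm (p x s))^-1 *: p x s).
Proof.
move=> p0 hp; apply: VKZ => //; apply: CKV.
  by move=> x s; rewrite gt_eqF // enorm_gt0.
by apply: CK_sqrt => [x s|]; [rewrite dot_gt0|exact: CK_dot].
Qed.

Lemma smooth_VK k m (g : I -> 'cV[R]_m.+1) : smooth g -> VK k (fun _ : X => g).
Proof.
move=> gs; have jc i : jcont (fun _ : X => cderivn i g).
  apply/jcont_cst/vder_continuous => t; exists (cderivn i.+1 g t); exact: smooth_vder.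
suff H i : VK k (fun _ : X => cderivn i g) by exact: (H 0%N).
elim: k i => [|k IH] i.
  exact/jcont_VK0/jc.
by apply: VKS (IH i.+1) => // x t; exact: smooth_vder.
Qed.

End VectorCalculus.

(** Single curves are treated as families constant in a dummy parameter in [R], evaluated at 0. *)
Lemma VK1_vder (R : realType) m (g : I01 R -> 'cV[R]_m.+1) t :
  VK 1 (fun _ : R => g) -> vder g t (cderiv g t).
Proof. by move=> /VK_cderiv[] /(_ 0 t). Qed.

(** * From curves in S^3 to pairs of curves in S^2 *)

Section ForwardMap.
Context {R : realType}.
Local Notation I := (I01 R).
Local Notation qone := (@qone R).
Local Notation qi := (@qi R).
Local Notation qj := (@qj R).
Local Notation qk := (@qk R).

(** The rotation [Pi4 zl zr] acting on quaternions; for [zl = zr] it restricts to [Pi3] on imaginary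
    ones. *)
Definition sw (zl zr q : 'cV[R]_4) : 'cV[R]_4 := qmul (qmul zl q) (qconj zr).

Lemma swD zl zr p q : sw zl zr (p + q) = sw zl zr p + sw zl zr q.
Proof. by rewrite /sw qmulDr qmulDl. Qed.

Lemma swZ zl zr a q : sw zl zr (a *: q) = a *: sw zl zr q.
Proof. by rewrite /sw qmulZr qmulZl. Qed.

Lemma dot_sw zl zr p q : unit_quat zl -> unit_quat zr ->
  dot (sw zl zr p) (sw zl zr q) = dot p q.
Proof.
by move=> /unit_quatP ul /unit_quatP ur; rewrite dot_qmulr dot_qconj ur dot_qmull ul !mul1r.
Qed.

(** The inner factor conj(z_r) z_r cancels: the product depends on z_l alone, which is why the left
    frame can be read off from g without a lift. [sw_conjl] does the same for z_r. *)
Lemma sw_conjr zl zr p q : unit_quat zr ->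
  qmul (sw zl zr p) (qconj (sw zl zr q)) = sw zl zl (qmul p (qconj q)).
Proof.
move=> ur; rewrite /sw !qconjM qconjK !qmulA -(qmulA _ (qconj zr)) unit_qmulVl //.
by rewrite qmulq1.
Qed.

Lemma sw_conjl zl zr p q : unit_quat zl ->
  qmul (qconj (sw zl zr p)) (sw zl zr q) = sw zr zr (qmul (qconj p) q).
Proof.
move=> ul; rewrite /sw !qconjM qconjK !qmulA -(qmulA _ (qconj zl)) unit_qmulVl //.
by rewrite qmulq1.
Qed.

Lemma dot_im3 (p q : 'cV[R]_4) : p ord0 0 = 0 -> dot (im3 p) (im3 q) = dot p q.
Proof.
move=> p0; rewrite [RHS]/dot big_ord_recl p0 mul0r add0r.
by apply: eq_bigr => i _; rewrite !im3E.
Qed.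

Lemma sw_real (z q : 'cV[R]_4) : q ord0 0 = 0 -> sw z z q ord0 0 = 0.
Proof. by move=> q0; rewrite conj_real q0 mulr0. Qed.

Lemma dot_im3_sw (z p q : 'cV[R]_4) : unit_quat z -> p ord0 0 = 0 ->
  dot (im3 (sw z z p)) (im3 (sw z z q)) = dot p q.
Proof. by move=> uz p0; rewrite dot_im3 ?sw_real // dot_sw. Qed.

Lemma col_Pi3E z : (col (inord 0) (Pi3 z) = im3 (sw z z qi)) *
  (col (inord 1) (Pi3 z) = im3 (sw z z qj)) * (col (inord 2) (Pi3 z) = im3 (sw z z qk)).
Proof. by do ![split]; rewrite col_Pi3 inordK. Qed.

Lemma col_Pi4E zl zr : (col (inord 0) (Pi4 zl zr) = sw zl zr qone) *
  (col (inord 1) (Pi4 zl zr) = sw zl zr qi) *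
  (col (inord 2) (Pi4 zl zr) = sw zl zr qj) * (col (inord 3) (Pi4 zl zr) = sw zl zr qk).
Proof. by do ![split]; rewrite col_Pi4 inordK. Qed.

(** Common to the left and right curves, which share [m] and differ in the lift [q] and in [n]. The
    two derivative hypotheses are the Frenet equations in S^2, with speed [m] and geodesic curvature
    [n / m]. *)
Lemma conj_curve (q : I -> 'cV[R]_4) (m n : I -> R) :
  let c t := im3 (sw (q t) (q t) qi) in
  (forall t, unit_quat (q t)) -> (forall t, 0 < m t) ->
  (forall t, vder (fun s => sw (q s) (q s) qi) t (m t *: sw (q t) (q t) qj)) ->
  (forall t, vder (fun s => sw (q s) (q s) qj) t
     (- m t *: sw (q t) (q t) qi + n t *: sw (q t) (q t) qk)) ->
  [/\ on_sphere c, generic c, forall t, frenet c t = Pi3 (q t),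
      forall t, speed c t = m t & forall t, kappa c t = n t / m t].
Proof.
move=> c uq m0 di dj.
have cd t : cderiv c t = m t *: im3 (sw (q t) (q t) qj).
  by rewrite (cderivE (vder_im3 (di t))) im3Z.
have fr t : frenet c t = Pi3 (q t) /\ row_free (\matrix_(k < 2) (cderivn k c t)^T).
  apply: (@frenet_triangular _ _ _ _ _ (fun _ _ => 0) (fun k => if k == 0%N then 1 else m t)).
  - exact: Pi3_SO.
  - by move=> [|k] _ //=; exact: m0.
  case=> [|[|//]] _.
    by rewrite big_ord0 add0r scale1r col_Pi3E.
  by rewrite big_ord1 scale0r add0r col_Pi3E /= -cd.
have sp t : speed c t = m t.
  rewrite /speed cd enormZ; last exact: ltW.
  rewrite (_ : enorm _ = 1) ?mulr1 //.
  by apply/enorm1P; rewrite dot_im3_sw ?dot_basis ?basis_real.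
split => // t.
- by apply/enorm1P; rewrite dot_im3_sw ?dot_basis ?basis_real.
- by case: (fr t).
- by case: (fr t).
- rewrite /kappa sp; congr (_ / _).
  have -> : frenet_col 1 c = (fun s => im3 (sw (q s) (q s) qj)).
    by apply/funext => s; rewrite /frenet_col (fr s).1 col_Pi3E.
  rewrite /frenet_col (fr t).1 col_Pi3E (cderivE (vder_im3 (dj t))).
  rewrite im3D !im3Z dotDl !dotZl !dot_im3_sw ?basis_real // !dot_basis.
  by rewrite mulr0 add0r mulr1.
Qed.

Definition normalize m (x : 'cV[R]_m) : 'cV[R]_m := (enorm x)^-1 *: x.

Lemma gram_schmidt3 m (u v w : 'cV[R]_m) :
  let e0 := normalize u in
  let e1 := normalize (v - dot v e0 *: e0) in
  let e2 := normalize (w - (dot w e0 *: e0 + dot w e1 *: e1)) in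
  gram_schmidt [:: u; v; w] = [:: e0; e1; e2].
Proof. by rewrite /gram_schmidt /= !big_cons !big_nil !addr0 subr0. Qed.

Definition tangent m (g : I -> 'cV[R]_m.+1) (t : I) : 'cV[R]_m.+1 := normalize (cderiv g t).

Lemma tangentE m (g : I -> 'cV[R]_m.+1) t : cderiv g t != 0 ->
  cderiv g t = speed g t *: tangent g t.
Proof. by move=> g1; rewrite scalerA mulfV ?scale1r // gt_eqF // enorm_gt0. Qed.

Lemma SO_expand n (M : 'M[R]_n) (v : 'cV[R]_n) : SO M ->
  v = \sum_j dot v (col j M) *: col j M.
Proof.
move=> [/mulmx1C MM _]; rewrite -[LHS]mul1mx -MM -mulmxA; apply/colP => i.
rewrite mxE summxE; apply: eq_bigr => j _; rewrite coordZ [RHS]mulrC !mxE.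
by congr (_ * _); apply: eq_bigr => k _; rewrite !mxE mulrC.
Qed.

End ForwardMap.

(** * Frenet equations of a curve in S^3 *)

Section FrenetEquations.
Context {R : realType}.
Local Notation I := (I01 R).

(** Applied to two columns of a frame, this gives the skew-symmetry of the Frenet matrix. *)
Lemma dot_cst_der m (p q : I -> 'cV[R]_m) t p' q' c : vder p t p' -> vder q t q' ->
  (forall s, dot (p s) (q s) = c) -> dot p' (q t) + dot (p t) q' = 0.
Proof.
move=> hp hq pq; apply: isder_unique (isder_dot hp hq) _.
by under eq_fun do rewrite pq; exact: isder_cst.
Qed.

Lemma sw_expand zl zr (v : 'cV[R]_4) : unit_quat zl -> unit_quat zr ->
  v = dot v (sw zl zr qone) *: sw zl zr qone + dot v (sw zl zr qi) *: sw zl zr qi +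
      dot v (sw zl zr qj) *: sw zl zr qj + dot v (sw zl zr qk) *: sw zl zr qk.
Proof.
move=> ul ur; rewrite [LHS](SO_expand v (Pi4_SO ul ur)).
by rewrite !big_ord_recl big_ord0 !col_Pi4 /= addr0 !addrA.
Qed.

Lemma sw_mul z zl zr (p q : 'cV[R]_4) : unit_quat z ->
  qmul (sw zl z p) (sw z zr q) = sw zl zr (qmul p q).
Proof.
move=> uz; rewrite /sw !qmulA -(qmulA _ (qconj z)) unit_qmulVl //.
by rewrite qmulq1.
Qed.

Lemma smooth_vder0 m (g : I -> 'cV[R]_m.+1) : smooth g -> forall t, vder g t (cderiv g t).
Proof. by move=> gs t; exact: (@smooth_vder _ _ g 0%N t). Qed.

Lemma generic_cderiv_neq0 n (g : I -> 'cV[R]_n.+3) t : generic g -> cderiv g t != 0.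
Proof.
move=> /(_ t) gen; apply/eqP => g1.
have := @row_free_lincomb _ _ _ _ (fun k : 'I_n.+2 => (val k == 1%N)%:R) gen _ (inord 1).
rewrite /= inordK // eqxx => /(_ _)/eqP; rewrite oner_eq0 => h; apply/notF/h.
rewrite (bigD1 (inord 1)) //= big1 ?addr0; last first.
  by move=> k; rewrite -val_eqE /= inordK // => /negPf ->; rewrite scale0r.
by rewrite inordK //= g1 scaler0.
Qed.

Lemma sphere_cderiv n (g : I -> 'cV[R]_n.+1) t : smooth g -> on_sphere g ->
  dot (cderiv g t) (g t) = 0.
Proof.
move=> gs sph; have gd : vder g t (cderiv g t) by exact: smooth_vder0.
have h := dot_cst_der gd gd (fun s => (enorm1P _).1 (sph s)).
rewrite (dotC (g t)) in h; lra.
Qed.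

(** [speed g], [m] and [w] are the subdiagonal entries of the skew-symmetric tridiagonal matrix
    F^{-1} F'. The columns after the first must be shown differentiable before they can be
    differentiated. *)
Lemma frenet_equations (g zl zr : I -> 'cV[R]_4) :
  smooth g -> on_sphere g -> generic g -> is_lift4 (frenet g) zl zr ->
  let e q t := sw (zl t) (zr t) q in
  g = e qone /\
  exists m w : I -> R, forall t,
    [/\ 0 < speed g t, 0 < m t, kappa g t = m t / speed g t & tau g t = w t / speed g t] /\
    [/\ vder g t (speed g t *: e qi t),
        vder (e qi) t (- speed g t *: g t + m t *: e qj t) &
        vder (e qj) t (- m t *: e qi t + w t *: e qk t)].
Proof.
move=> gs sph gen [_ u _ FE] e.
have ul t := (u t).1; have ur t := (u t).2.
have de t p q : dot (e p t) (e q t) = dot p q by exact: dot_sw.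
have SF t : SO (frenet g t) by rewrite -FE; exact: Pi4_SO.
have gd t : vder g t (cderiv g t) by exact: smooth_vder0.
have gs1 := smooth_cderiv gs.
have g1d t : vder (cderiv g) t (cderiv (cderiv g) t) by exact: smooth_vder0.
have colE t (i : 'I_3) : col (inord i) (Pi4 (zl t) (zr t)) =
    (gram_schmidt [:: g t; cderiv g t; cderiv (cderiv g) t])`_i.
  have [_ /(_ i)] := frenet_setP (SF t); rewrite FE => <-.
  by congr (col _ _); apply: val_inj; rewrite /= inordK // ltnW // ltnS.
have g1n0 t : cderiv g t != 0 by exact: generic_cderiv_neq0.
have v0 t : 0 < speed g t by rewrite enorm_gt0.
have ng t : normalize (g t) = g t by rewrite /normalize sph invr1 scale1r.
have E0 : g = e qone.
  apply/funext => t; have := colE t (inord 0).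
  by rewrite inordK // col_Pi4E gram_schmidt3 /= ng.
split => //.
have E1 : e qi = tangent g.
  apply/funext => t; have := colE t (inord 1).
  rewrite inordK // col_Pi4E gram_schmidt3 /= ng sphere_cderiv //.
  by rewrite scale0r subr0.
have g1E t : cderiv g t = speed g t *: e qi t.
  by rewrite E1 tangentE.
(* Third Gram-Schmidt vector before normalization. *)
pose w2 t := cderiv (cderiv g) t -
  (dot (cderiv (cderiv g) t) (g t) *: g t + dot (cderiv (cderiv g) t) (e qi t) *: e qi t).
have E2 t : e qj t = normalize (w2 t).
  have := colE t (inord 2).
  rewrite inordK // col_Pi4E gram_schmidt3 /= ng sphere_cderiv //.
  by rewrite scale0r subr0 -/(tangent g t) -E1.
(* If it vanished, g, g', g'' would satisfy a linear relation with coefficient 1 on g''. The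
   coefficient of g' is divided by the speed because g' is the speed times [e qi]. *)
have w2n0 t : w2 t != 0.
  apply/eqP => w20; have := @row_free_lincomb _ _ _ _
    (fun k : 'I_3 => [:: - dot (cderiv (cderiv g) t) (g t);
       - (dot (cderiv (cderiv g) t) (e qi t) / speed g t); 1]`_k) (gen t) _ (inord 2).
  rewrite inordK //= => /(_ _)/eqP; rewrite oner_eq0 => h; apply/notF/h.
  rewrite !big_ord_recl big_ord0 /cderivn /= addr0 scale1r [cderiv g t]g1E scalerA.
  rewrite mulNr divfK ?gt_eqF // -[RHS]w20 /w2 opprD !scaleNr addrA.
  by rewrite [RHS]addrC.
have w20 t : 0 < enorm (w2 t) by rewrite enorm_gt0.
have w2E t : w2 t = enorm (w2 t) *: e qj t.
  by rewrite E2 /normalize scalerA mulfV ?scale1r // gt_eqF.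
have g2E t : cderiv (cderiv g) t = dot (cderiv (cderiv g) t) (g t) *: e qone t +
    dot (cderiv (cderiv g) t) (e qi t) *: e qi t + enorm (w2 t) *: e qj t.
  by rewrite -w2E -E0 /w2 addrC subrK.
have g2k t : dot (cderiv (cderiv g) t) (e qk t) = 0.
  by rewrite g2E !dotDl !dotZl !de !dot_basis !mulr0 !addr0.
have g2j t : dot (cderiv (cderiv g) t) (e qj t) = enorm (w2 t).
  by rewrite {1}g2E !dotDl !dotZl !de !dot_basis !mulr0 !add0r mulr1.
have tV k : VK k (fun _ : R => e qi).
  by rewrite E1; apply: VK_normalize => //; apply: smooth_VK.
have vV k : CK k (fun _ : R => speed g).
  apply: CK_sqrt => [_ t|]; first by rewrite dot_gt0.
  by apply: CK_dot; exact: smooth_VK.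
have e1d t : vder (e qi) t (cderiv (e qi) t) by apply: VK1_vder.
(* From g' = v e_i follows g'' = v' e_i + v e_i': since v > 0, e_i' inherits from g'' a positive
   component along [e qj] and none along [e qk]. *)
have g2e1 t : exists a, cderiv (cderiv g) t = a *: e qi t + speed g t *: cderiv (e qi) t.
  have vd : isder (speed g) t (dot (cderiv (cderiv g) t) (e qi t) +
      dot (cderiv g t) (cderiv (e qi) t)).
    have -> : speed g = fun s => dot (cderiv g s) (e qi s).
      by apply/funext => s; rewrite g1E dotZl de dot_basis mulr1.
    exact: isder_dot.
  eexists; apply: vder_unique (g1d t) _.
  rewrite (_ : cderiv g = fun s => speed g s *: e qi s); last by apply/funext.
  exact: vderZ vd (e1d t).
pose m t := dot (cderiv (e qi) t) (e qj t).
have m0 t : 0 < m t.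
  have [a ga] := g2e1 t; have := g2j t.
  rewrite ga dotDl !dotZl de dot_basis mulr0 add0r => mE.
  by rewrite -(pmulr_rgt0 _ (v0 t)) mE.
have e1k t : dot (cderiv (e qi) t) (e qk t) = 0.
  have [a ga] := g2e1 t; have := g2k t.
  rewrite ga dotDl !dotZl de dot_basis mulr0 add0r => /eqP.
  by rewrite mulf_eq0 gt_eqF // => /eqP.
have dcst p q t p' q' : vder (e p) t p' -> vder (e q) t q' ->
    dot p' (e q t) = - dot q' (e p t).
  move=> hp hq; apply/eqP; rewrite -addr_eq0 (dotC q').
  by rewrite (dot_cst_der hp hq (fun s => de s p q)).
have e0d t : vder (e qone) t (cderiv g t) by rewrite -E0.
have e1E t : cderiv (e qi) t = - speed g t *: g t + m t *: e qj t.
  rewrite [LHS](sw_expand _ (ul t) (ur t)) -!/(e _ t) e1k scale0r addr0 -/(m t).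
  rewrite (dcst _ _ _ _ _ (e1d t) (e0d t)) g1E dotZl de dot_basis mulr1 -E0.
  have : dot (cderiv (e qi) t) (e qi t) = 0.
    by have := dcst _ _ _ _ _ (e1d t) (e1d t) => h; lra.
  by move=> ->; rewrite scale0r addr0.
(* Solving the equation of e_i' for [e qj] writes it as the normalization of a smooth nonvanishing
   curve, hence makes it differentiable. *)
have E2n : e qj = fun t => normalize (cderiv (e qi) t + speed g t *: g t).
  apply/funext => t; rewrite e1E addrAC scaleNr addNr add0r /normalize enormZ ?ltW //.
  rewrite (_ : enorm (e qj t) = 1); last by apply/enorm1P; rewrite de dot_basis.
  by rewrite mulr1 scalerA mulVf ?scale1r // gt_eqF.
have e2V k : VK k (fun _ : R => e qj).
  rewrite E2n; apply: VK_normalize => [_ t|].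
    rewrite e1E addrAC scaleNr addNr add0r -dot_gt0 dotZl dotZr de dot_basis.
    by rewrite mulr1 mulr_gt0.
  have [_ e1V] := VK_cderiv (tV k.+1).
  exact: VKD e1V (VKZ (vV k) (smooth_VK k gs)).
have e2d t : vder (e qj) t (cderiv (e qj) t) by apply: VK1_vder.
pose w t := dot (cderiv (e qj) t) (e qk t).
have e2E t : cderiv (e qj) t = - m t *: e qi t + w t *: e qk t.
  rewrite [LHS](sw_expand _ (ul t) (ur t)) -!/(e _ t) -/(w t).
  rewrite (dcst _ _ _ _ _ (e2d t) (e0d t)) g1E dotZl de dot_basis mulr0 oppr0 scale0r add0r.
  rewrite (dcst _ _ _ _ _ (e2d t) (e1d t)) -/(m t).
  have : dot (cderiv (e qj) t) (e qj t) = 0.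
    by have := dcst _ _ _ _ _ (e2d t) (e2d t) => h; lra.
  by move=> ->; rewrite scale0r addr0.
(* (z_l i conj(z_l)) (z_l j conj(z_r)) = z_l k conj(z_r), a product of curves already known to be
   differentiable. *)
have E3 : e qk = fun t => qmul (qmul (e qi t) (qconj (g t))) (e qj t).
  by apply/funext => t; rewrite E0 sw_conjr // sw_mul // qconj1 qmulq1 qmul_basis.
have e3d t : exists l, vder (e qk) t l.
  eexists; rewrite E3; apply: vder_qmul (e2d t); apply: vder_qmul (e1d t) _.
  exact: vder_qconj (gd t).
have f1 : frenet_col 1 g = e qi by apply/funext => s; rewrite /frenet_col -FE col_Pi4E.
have f2 : frenet_col 2 g = e qj by apply/funext => s; rewrite /frenet_col -FE col_Pi4E.
have f3 : frenet_col 3 g = e qk by apply/funext => s; rewrite /frenet_col -FE col_Pi4E.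
exists m, w => t; split; first split => //.
- by rewrite /kappa f1 f2.
- rewrite /tau f2 f3; have [l hl] := e3d t.
  by rewrite (cderivE hl) (dcst _ _ _ _ _ hl (e2d t)) opprK.
split; first by rewrite -g1E.
- by rewrite -e1E.
- by rewrite -e2E.
Qed.

End FrenetEquations.

Section ForwardCurves.
Context {R : realType}.
Local Notation I := (I01 R).

Definition left_part (g : I -> 'cV[R]_4) (t : I) : 'cV[R]_3 :=
  im3 (qmul (tangent g t) (qconj (g t))).

Definition right_part (g : I -> 'cV[R]_4) (t : I) : 'cV[R]_3 :=
  im3 (qmul (qconj (g t)) (tangent g t)).

(** Serves both to compute the parts of a given curve and to check that the curve built from a pair
    has this pair as its parts. *)
Lemma parts_sw (g : I -> 'cV[R]_4) t (zl zr : 'cV[R]_4) (a : R) :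
  unit_quat zl -> unit_quat zr -> 0 < a ->
  g t = sw zl zr qone -> cderiv g t = a *: sw zl zr qi ->
  left_part g t = im3 (sw zl zl qi) /\ right_part g t = im3 (sw zr zr qi).
Proof.
move=> ul ur a0 gE g1E; have tE : tangent g t = sw zl zr qi.
  rewrite /tangent g1E /normalize enormZ ?ltW // (_ : enorm (sw _ _ _) = 1).
    by rewrite mulr1 scalerA mulVf ?scale1r // gt_eqF.
  by apply/enorm1P; rewrite dot_sw // dot_basis.
rewrite /left_part /right_part tE gE sw_conjr // sw_conjl //.
by rewrite qconj1 qmulq1 qmul1.
Qed.

Lemma forward_curves (g zl zr : I -> 'cV[R]_4) :
  smooth g -> on_sphere g -> generic g -> is_lift4 (frenet g) zl zr ->
  let gl := left_part g in let gr := right_part g in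
  [/\ forall t, 0 < speed g t * kappa g t,
      g = fun t => qmul (zl t) (qconj (zr t)),
      [/\ on_sphere gl, generic gl, forall t, frenet gl t = Pi3 (zl t),
          forall t, speed gl t = speed g t * kappa g t &
          forall t, kappa gl t = (tau g t + 1) / kappa g t] &
      [/\ on_sphere gr, generic gr, forall t, frenet gr t = Pi3 (zr t),
          forall t, speed gr t = speed g t * kappa g t &
          forall t, kappa gr t = (tau g t - 1) / kappa g t]].
Proof.
move=> gs sph gen lift gl gr; have [_ u _ _] := lift.
have ul t := (u t).1; have ur t := (u t).2.
have [gE [m [w mw]]] := frenet_equations gs sph gen lift.
pose v t := speed g t.
have v0 t : 0 < v t by have [[]] := mw t.
have m0 t : 0 < m t by have [[]] := mw t.
have kE t : kappa g t = m t / v t by have [[]] := mw t.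
have tE t : tau g t = w t / v t by have [[]] := mw t.
pose e q t := sw (zl t) (zr t) q.
have gd t : vder g t (v t *: e qi t) by have [_ []] := mw t.
have e1d t : vder (e qi) t (- v t *: e qone t + m t *: e qj t).
  by rewrite -[e qone t](congr1 (@^~ t) gE); have [_ []] := mw t.
have e2d t : vder (e qj) t (- m t *: e qi t + w t *: e qk t) by have [_ []] := mw t.
have vk t : v t * kappa g t = m t by rewrite kE mulrCA mulfV ?mulr1 // gt_eqF.
have parts t := parts_sw (ul t) (ur t) (v0 t) (congr1 (@^~ t) gE) (cderivE (gd t)).
have glE : gl = fun t => im3 (sw (zl t) (zl t) qi) by apply/funext => t; have [] := parts t.
have grE : gr = fun t => im3 (sw (zr t) (zr t) qi) by apply/funext => t; have [] := parts t.
have cd t := vder_qconj (gd t).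
have lE q : (fun s => sw (zl s) (zl s) q) = fun s => qmul (e q s) (qconj (g s)).
  by apply/funext => s; rewrite gE sw_conjr // qconj1 qmulq1.
have rE q : (fun s => sw (zr s) (zr s) q) = fun s => qmul (qconj (g s)) (e q s).
  by apply/funext => s; rewrite gE sw_conjl // qconj1 qmul1.
have gt t : g t = e qone t by rewrite gE.
(* In the derivative of e_j conj(g) the factor conj(g)' contributes v j conj(i) = v k, hence
   [w + v]. In that of e_i conj(g) the real terms -v and v i conj(i) cancel. *)
have [||l1 l2 l3 l4 l5] := @conj_curve R zl m (fun t => w t + v t) ul m0.
- move=> t; rewrite lE; apply: vder_eq (vder_qmul (e1d t) (cd t)) _.
  rewrite gt qconjZ qmulDl !qmulZl !qmulZr !sw_conjr // qconj1 !qmulq1 !qmul_basis.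
  by rewrite qmulNr qmul_basis opprK addrAC scaleNr addNr add0r.
- move=> t; rewrite lE; apply: vder_eq (vder_qmul (e2d t) (cd t)) _.
  rewrite gt qconjZ qmulDl !qmulZl !qmulZr !sw_conjr // qconj1 !qmulq1 !qmul_basis.
  by rewrite qmulNr qmul_basis opprK -addrA -scalerDl.
(* In the opposite order the extra term is v conj(i) j = - v k, hence [w - v]. *)
have [||r1 r2 r3 r4 r5] := @conj_curve R zr m (fun t => w t - v t) ur m0.
- move=> t; rewrite rE; apply: vder_eq (vder_qmul (cd t) (e1d t)) _.
  rewrite gt qconjZ qmulDr !qmulZl !qmulZr !sw_conjl // qconj1 !qmul1 !qmul_basis.
  by rewrite qmulNl qmul_basis opprK addrA -scalerDl subrr scale0r add0r.
- move=> t; rewrite rE; apply: vder_eq (vder_qmul (cd t) (e2d t)) _.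
  rewrite gt qconjZ qmulDr !qmulZl !qmulZr !sw_conjl // qconj1 !qmul1 !qmul_basis.
  rewrite qmulNl qmul_basis /sw qmulNr qmulNl scalerN addrCA -scaleNr -scalerDl.
  by rewrite (addrC (w t)).
split; [by move=> t; rewrite vk| by rewrite gE; apply/funext => t; rewrite /sw qmulq1| |].
- rewrite glE; split => // t; rewrite ?l4 ?l5 -/(v t) ?vk // kE tE.
  by field; rewrite !gt_eqF.
- rewrite grE; split => // t; rewrite ?r4 ?r5 -/(v t) ?vk // kE tE.
  by field; rewrite !gt_eqF.
Qed.

End ForwardCurves.

(** * Lifts of frames *)

Section Lift.
Context {R : realType}.
Local Notation I := (I01 R).

(* As [x - i x i - j x j - k x k = 4 Re x], this is [<z, q> z] ([lift_projE]), written
   in terms of the frame of [z] only. *)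
Definition lift_proj (z q : 'cV[R]_4) : 'cV[R]_4 :=
  4^-1 *: (q - (qmul (qmul (sw z z qi) q) qi + qmul (qmul (sw z z qj) q) qj +
                qmul (qmul (sw z z qk) q) qk)).

Lemma lift_projE z q : unit_quat z -> lift_proj z q = dot z q *: z.
Proof.
move=> uz.
have e4 (p : 'cV[R]_4) :
    p - (qmul (qmul qi p) qi + qmul (qmul qj p) qj + qmul (qmul qk p) qk) =
    4 * dot qone p *: qone.
  have [a [b [c [d ->]]]] := quat_surj p.
  rewrite /qi /qj /qk /qone !qmul_quat !quatD quatN quatD dot_quat quatZ.
  by congr quat; ring.
(* The substitution q = z w moves z to the left of every term, which reduces the claim to z = 1; the
   real part of w is <z, q>. *)
have [w ->] : exists w, q = qmul z w.
  by exists (qmul (qconj z) q); rewrite qmulA unit_qmulV // qmul1.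
have se e : qmul (qmul (sw z z e) (qmul z w)) e = qmul z (qmul (qmul e w) e).
  by rewrite /sw -!qmulA (qmulA (qconj z)) unit_qmulVl // qmul1.
have := congr1 (qmul z) (e4 w); rewrite qmulDr qmulNr !qmulDr qmulZr qmulq1 => e4w.
rewrite /lift_proj (se qi) (se qj) (se qk) e4w scalerA mulrA.
rewrite mulVf ?pnatr_eq0 // mul1r; congr (_ *: _).
by rewrite -{1}(qmulq1 z) dot_qmull (unit_quatP _).1 // mul1r.
Qed.

Lemma sw_Pi3 (z q : 'cV[R]_4) : q ord0 0 = 0 -> sw z z q = imq (Pi3 z *m im3 q).
Proof. by move=> q0; rewrite Pi3E imq_conj ?imq_real // imq_im3. Qed.

Lemma dot_dist (z w : 'cV[R]_4) : unit_quat z -> unit_quat w ->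
  dot (z - w) (z - w) = 2 * (1 - dot z w).
Proof.
move=> /unit_quatP uz /unit_quatP uw.
by rewrite dotDl !dotDr !dotNl !dotNr uz uw (dotC w); ring.
Qed.

Lemma coord_le_dot m (u : 'cV[R]_m) i : u i 0 ^+ 2 <= dot u u.
Proof.
rewrite /dot (bigD1 i) //= -expr2 lerDl; apply: sumr_ge0 => j _.
by rewrite -expr2 sqr_ge0.
Qed.

Lemma continuous_dot (p q : I -> 'cV[R]_4) : continuous p -> continuous q ->
  continuous (fun t => dot (p t) (q t)).
Proof.
have VK0 (u : I -> 'cV[R]_4) : continuous u -> VK 0 (fun _ : R => u).
  by move=> uc; apply: jcont_VK0; exact: jcont_cst.
move=> /VK0 pc /VK0 qc.
exact: (@jcont_slice _ _ _ _ 0 (CK_jcont (CK_dot pc qc))).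
Qed.

(* The frames determine [<z, w>^2]; the sign of [<z, w>] is constant as it never
   vanishes. *)
Lemma lift_near (z w : I -> 'cV[R]_4) d : continuous z -> continuous w ->
  (forall t, unit_quat (z t)) -> (forall t, unit_quat (w t)) -> z t0 = w t0 ->
  d < 1 ->
  (forall t, 1 - d < dot (lift_proj (z t) (w t)) (w t)) ->
  forall t, dot (z t - w t) (z t - w t) < 2 * d.
Proof.
move=> zc wc uz uw zw0 d1 zw t.
pose c t := dot (z t) (w t).
have c2 s : 1 - d < c s ^+ 2.
  by rewrite expr2; have := zw s; rewrite lift_projE // dotZl.
have cp : 0 < c t.
  apply: (@continuous_nowhere_zero_gt0 R c) => [||s].
  - exact: continuous_dot.
  - by rewrite /c zw0 (unit_quatP _).1.
  - apply/eqP => cs; have := c2 s; rewrite cs expr0n /=; lra.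
(* As |z - w|^2 = 2 (1 - c) and 0 < c <= 1, it suffices that 1 - d < c^2 <= c. *)
rewrite dot_dist // -/(c t) ltr_pM2l // ltrBlDr -ltrBlDl.
have c1 : c t <= 1.
  by rewrite -subr_ge0 -(@pmulr_rge0 _ 2) // -dot_dist // dot_ge0.
by apply: lt_le_trans (c2 t) _; rewrite expr2 ler_piMl // ltW.
Qed.

(** Equal frames give equal projections, and the projection of w along w is w itself, so [lift_near]
    applies with arbitrarily small d. *)
Lemma lift_unique (z w : I -> 'cV[R]_4) : continuous z -> continuous w ->
  (forall t, unit_quat (z t)) -> (forall t, unit_quat (w t)) -> z t0 = w t0 ->
  (forall t, Pi3 (z t) = Pi3 (w t)) -> z = w.
Proof.
move=> zc wc uz uw zw0 zwP; apply/funext => t; apply/eqP.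
rewrite -subr_eq0 -dot_eq0 eq_le dot_ge0 andbT; apply/ler_addgt0Pr => e e0.
rewrite add0r; pose d := Num.min (e / 2) (1 / 2).
have de : d <= e / 2 by rewrite ge_min lexx.
have d1 : d <= 1 / 2 by rewrite ge_min lexx orbT.
have d0 : 0 < d by rewrite lt_min !divr_gt0.
have pE s q : lift_proj (z s) q = lift_proj (w s) q.
  by rewrite /lift_proj !(sw_Pi3 (z s)) ?basis_real // zwP -!sw_Pi3 ?basis_real.
have d1' : d < 1 by lra.
have : dot (z t - w t) (z t - w t) < 2 * d.
  apply: lift_near => // s.
  by rewrite pE lift_projE // dotZl (unit_quatP _).1 // mulr1; lra.
by move=> h; lra.
Qed.

Context {X : topologicalType}.

Lemma VK_sw_qk k (z : X -> I -> 'cV[R]_4) : (forall x t, unit_quat (z x t)) ->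
  VK k (fun x t => sw (z x t) (z x t) qi) -> VK k (fun x t => sw (z x t) (z x t) qj) ->
  VK k (fun x t => sw (z x t) (z x t) qk).
Proof.
move=> uz ik jk; rewrite (_ : (fun x t => _) = fun x t =>
  qmul (sw (z x t) (z x t) qi) (sw (z x t) (z x t) qj)); first exact: VK_qmul.
by apply/funext => x; apply/funext => t; rewrite sw_mul // qmul_basis.
Qed.

(** Continuous dependence of the lift on the frame, uniformly in t. *)
Lemma lift_jcont (z : X -> I -> 'cV[R]_4) :
  (forall x t, unit_quat (z x t)) -> (forall x, continuous (z x)) ->
  (forall x, z x t0 = qone) ->
  jcont (fun x t => sw (z x t) (z x t) qi) -> jcont (fun x t => sw (z x t) (z x t) qj) ->
  jcont z.
Proof.
move=> uz zc z1 ji jj.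
have [ik jk] := (jcont_VK0 ji, jcont_VK0 jj).
have kk := VK_sw_qk uz ik jk.
apply/jcont_uniform; split=> // x0.
(* This is <z x t, z x0 t>^2, but written through the frame of [z x], so its joint continuity does
   not presuppose that of z. It equals 1 at x0. *)
pose F x t := dot (lift_proj (z x t) (z x0 t)) (z x0 t).
have Fj : jcont F.
  have w0 : VK 0 (fun (_ : X) t => z x0 t) by apply: jcont_VK0; exact: jcont_cst.
  have term (a : X -> I -> 'cV[R]_4) (q : 'cV[R]_4) :
      VK 0 a -> VK 0 (fun x t => qmul (qmul (a x t) (z x0 t)) q).
    by move=> ak; exact: VK_qmul (VK_qmul ak w0) (VK_cst 0 q).
  apply: (@CK_jcont _ _ 0); apply: CK_dot => //; apply: VKZ; first exact: CK_cst.
  apply: VKD => //; apply: VKN.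
  exact: VKD (VKD (term _ qi ik) (term _ qj jk)) (term _ qk kk).
move: Fj => /(@jcont_uniform R X R)[_] Fu.
move=> P /uniform_nbhs[E [entE EP]].
move: entE; rewrite -entourage_ballE => -[e /= e0 eE].
(* [lift_near] bounds |z x0 - z x|^2 by 2 d <= e^2 and requires d < 1. *)
pose d := Num.min (e ^+ 2 / 2) (1 / 2).
have de : d <= e ^+ 2 / 2 by rewrite ge_min lexx.
have d1 : d <= 1 / 2 by rewrite ge_min lexx orbT.
have d0 : 0 < d by rewrite lt_min !divr_gt0 // exprn_gt0.
have dU : nbhs (F x0 : {uniform I -> R}) [set h | forall t, ball (F x0 t) d (h t)].
  apply/uniform_nbhs; exists [set xy | ball xy.1 d xy.2].
  split; last by move=> h hh t; exact: hh.
  by rewrite -entourage_ballE; exists d.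
have F1 t : F x0 t = 1 by rewrite /F lift_projE // dotZl (unit_quatP _).1 // mulr1.
suff : nbhs x0 (z @^-1` P) by [].
apply: (@filterS _ _ (nbhs_filter x0)) (Fu x0 _ dU) => x hx.
apply: (EP (z x)) => t _; apply: eE; split => //= i j; rewrite ord1.
have zz : dot (z x0 t - z x t) (z x0 t - z x t) < 2 * d.
  rewrite dot_dist // dotC -dot_dist //; apply: lift_near => //; first by rewrite !z1.
    lra.
  move=> s; have := hx s; rewrite F1 /ball /= => /ltr_distlBl; exact.
have := le_lt_trans (coord_le_dot _ i) zz; rewrite !mxE => lt2d.
rewrite /ball /= -(@ltr_pXn2r _ 2) ?nnegrE ?(ltW e0) // -normrX ger0_norm ?sqr_ge0 //.
by apply: lt_le_trans lt2d _; lra.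
Qed.

(** The projected vector is frozen at [z t]: then [q] depends on s through the frame only, so it is
    differentiable with derivative [p], and z is recovered from q by removing the factor c = <z s, z
    t>. *)
Lemma lift_vder (z : I -> 'cV[R]_4) t (i' j' k' : 'cV[R]_4) :
  continuous z -> (forall t, unit_quat (z t)) ->
  vder (fun s => sw (z s) (z s) qi) t i' -> vder (fun s => sw (z s) (z s) qj) t j' ->
  vder (fun s => sw (z s) (z s) qk) t k' ->
  let p := - 4^-1 *: (qmul (qmul i' (z t)) qi + qmul (qmul j' (z t)) qj +
                      qmul (qmul k' (z t)) qk) in
  vder z t (p - (dot p (z t) / 2) *: z t).
Proof.
move=> zc uz di dj dk p.
pose q s := lift_proj (z s) (z t).
have dq a a' (e : 'cV[R]_4) : vder a t a' ->
    vder (fun s => qmul (qmul (a s) (z t)) e) t (qmul (qmul a' (z t)) e).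
  move=> da; apply: vder_eq (vder_qmul (vder_qmul da (vder_cst (z t) t)) (vder_cst e t)) _.
  by rewrite !qmulq0 !addr0.
have qE : q = fun s => 4^-1 *: z t + - 4^-1 *: (qmul (qmul (sw (z s) (z s) qi) (z t)) qi +
    qmul (qmul (sw (z s) (z s) qj) (z t)) qj + qmul (qmul (sw (z s) (z s) qk) (z t)) qk).
  by apply/funext => s; rewrite /q /lift_proj scalerDr scalerN scaleNr.
have qd : vder q t p.
  rewrite qE; apply: vder_eq (vderD (vder_cst (4^-1 *: z t) t)
    (vderZ (isder_cst (- 4^-1) t)
       (vderD (vderD (dq _ _ qi di) (dq _ _ qj dj)) (dq _ _ qk dk)))) _.
  by rewrite add0r scale0r add0r.
(* With [c s = <z s, z t>] we have [q = c z] and [r = - c^2], so that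
   [z s - z t = (q s - q t) + z s (r s - r t) / (1 + c s)]. *)
pose r s := - dot (q s) (z t).
have rd : isder r t (- dot p (z t)).
  apply: isder_eq (isderN (isder_dot qd (vder_cst (z t) t))) _.
  by rewrite (dotC _ 0) dot0l addr0.
pose c s := dot (z s) (z t).
have rE s : r s = - (c s * c s) by rewrite /r /q lift_projE // dotZl.
have ct : c t = 1 by rewrite /c (unit_quatP _).1.
have zt : continuous (fun _ : I => z t) by exact: cst_continuous.
have cont_c : continuous c by exact: (@continuous_dot z (fun=> z t) zc zt).
have cc : c @ t^' --> c t by apply/continuous_withinNx; exact: cont_c.
move=> l.
have zl : (fun s => z s l 0) @ t^' --> z t l 0.
  apply: (continuous_cvg _ (@coord_continuous _ _ _ l 0 (z t))).
  by apply/continuous_withinNx; exact: zc.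
(* The limit of this denominator is 2, the origin of the half in the conclusion. *)
have c1 : 1 + c t != 0 by rewrite ct -(natrD _ 1 1) pnatr_eq0.
have cc1 : (fun s => 1 + c s) @ t^' --> 1 + c t.
  by apply: cvgD => //; exact: cvg_cst.
have H := cvgD (qd l) (cvgM zl (cvgM rd (cvgV c1 cc1))).
apply: (@isder_near _ _ _ _ (fun s => (val s - val t)^-1 * (q s l 0 - q t l 0) +
  z s l 0 * ((val s - val t)^-1 * (r s - r t) * (1 + c s)^-1))).
  near=> s; have cs : 1 + c s != 0 by near: s; exact: cvgr_neq0 cc1 c1.
  have st : s != t by near: s; exact: near_dnbhs_neq.
  have := val_neq st; rewrite !rE ct /q !lift_projE // !coordZ -!/(c _) ct => ?.
  by field; apply/andP.
rewrite coordD -scaleNr [X in _ + X]coordZ.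
have -> : - (dot p (z t) / 2) * z t l 0 = z t l 0 * (- dot p (z t) * (1 + c t)^-1).
  by rewrite ct; field.
exact: H.
Unshelve. all: by end_near. Qed.

End Lift.

Section LiftRegularity.
Context {R : realType} {X : topologicalType}.
Local Notation I := (I01 R).

(** Bootstrap: by [lift_vder] the derivative of z is polynomial in z and the derivatives of the
    frame, so z gains one order at a time until it is as regular as the frame. Lifting itself loses
    no derivative. *)
Lemma lift_VK k (z : X -> I -> 'cV[R]_4) :
  (forall x t, unit_quat (z x t)) -> (forall x, continuous (z x)) ->
  (forall x, z x t0 = qone) ->
  VK k (fun x t => sw (z x t) (z x t) qi) -> VK k (fun x t => sw (z x t) (z x t) qj) ->
  VK k z.
Proof.
move=> uz zc z1; have zj k' : VK k' (fun x t => sw (z x t) (z x t) qi) ->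
    VK k' (fun x t => sw (z x t) (z x t) qj) -> jcont z.
  by move=> /VK_jcont ik /VK_jcont jk; exact: lift_jcont.
elim: k => [|k IH] ik jk.
  exact/jcont_VK0/(zj _ ik jk).
have kk := VK_sw_qk uz ik jk.
have zk : VK k z by apply: IH; exact: VK_le (leqnSn k) _.
have [id i'k] := VK_cderiv ik; have [jd j'k] := VK_cderiv jk; have [kd k'k] := VK_cderiv kk.
pose p x t := - 4^-1 *: (qmul (qmul (cderiv (fun s => sw (z x s) (z x s) qi) t) (z x t)) qi +
  qmul (qmul (cderiv (fun s => sw (z x s) (z x s) qj) t) (z x t)) qj +
  qmul (qmul (cderiv (fun s => sw (z x s) (z x s) qk) t) (z x t)) qk).
have pk : VK k p.
  have term (a : X -> I -> 'cV[R]_4) (q : 'cV[R]_4) :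
      VK k a -> VK k (fun x t => qmul (qmul (a x t) (z x t)) q).
    by move=> ak; exact: VK_qmul (VK_qmul ak zk) (VK_cst k q).
  exact: VKZ (CK_cst k _) (VKD (VKD (term _ qi i'k) (term _ qj j'k)) (term _ qk k'k)).
apply: (VKS (g' := fun x t => p x t + (- (2^-1) * dot (p x t) (z x t)) *: z x t)).
- exact: zj ik jk.
- move=> x t; apply: vder_eq (lift_vder (zc x) (uz x) (id x t) (jd x t) (kd x t)) _.
  by rewrite -scaleNr -/(p x t) mulNr mulrC.
- apply: VKD => //; apply: VKZ => //; apply: CKM; first exact: CK_cst.
  exact: CK_dot.
Qed.

End LiftRegularity.

(** * Differential equation of the lift of a frame in SO_3 *)

Section BackwardMap.
Context {R : realType}.
Local Notation I := (I01 R).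

Lemma lift3_frame (g : I -> 'cV[R]_3) z t :
  smooth g -> on_sphere g -> generic g -> is_lift3 (frenet g) z ->
  sw (z t) (z t) qi = imq (g t) /\ sw (z t) (z t) qj = imq (tangent g t).
Proof.
move=> gs sph gen [_ uz _ FE].
have SF : SO (frenet g t) by rewrite -FE; exact: Pi3_SO.
have ng : normalize (g t) = g t by rewrite /normalize sph invr1 scale1r.
have colE (i : 'I_2) : col (inord i) (Pi3 (z t)) =
    (gram_schmidt [:: g t; cderiv g t])`_i.
  have [_ /(_ i)] := frenet_setP SF; rewrite FE => <-.
  by congr (col _ _); apply: val_inj; rewrite /= inordK // ltnW // ltnS.
have gsE : gram_schmidt [:: g t; cderiv g t] = [:: g t; tangent g t].
  rewrite /gram_schmidt /= big_cons !big_nil subr0 addr0 -/(normalize (g t)) ng.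
  by rewrite sphere_cderiv // scale0r subr0.
have := colE (inord 0); have := colE (inord 1).
rewrite !inordK // !gsE !col_Pi3E /= => <- <-.
by rewrite !imq_conj ?basis_real.
Qed.

Lemma vder_sw (zl zr : I -> 'cV[R]_4) t wl wr q :
  vder zl t (qmul (zl t) wl) -> vder zr t (qmul (zr t) wr) ->
  vder (fun s => sw (zl s) (zr s) q) t (sw (zl t) (zr t) (qmul wl q + qmul q (qconj wr))).
Proof.
move=> dl dr.
apply: vder_eq (vder_qmul (vder_qmul dl (vder_cst q t)) (vder_qconj dr)) _.
by rewrite qmulq0 addr0 swD qconjM /sw !qmulA.
Qed.

Lemma lift3_vder (g : I -> 'cV[R]_3) z t :
  smooth g -> on_sphere g -> generic g -> is_lift3 (frenet g) z ->
  (forall k, VK k (fun _ : R => z)) /\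
  vder z t (qmul (z t) (quat 0 (speed g t * kappa g t / 2) 0 (speed g t / 2))).
Proof.
move=> gs sph gen lift; have [zc uz z1 FE] := lift.
have fr s := lift3_frame s gs sph gen lift.
have g1n0 s : cderiv g s != 0 by exact: generic_cderiv_neq0.
have v0 s : 0 < speed g s by rewrite enorm_gt0.
have iE : (fun s => sw (z s) (z s) qi) = fun s => imq (g s).
  by apply/funext => s; have [] := fr s.
have jE : (fun s => sw (z s) (z s) qj) = fun s => imq (tangent g s).
  by apply/funext => s; have [] := fr s.
have zV k : VK k (fun _ : R => z).
  apply: lift_VK => //; rewrite ?iE ?jE; apply: VK_imq; first exact: smooth_VK.
  by apply: VK_normalize => //; exact: smooth_VK (smooth_cderiv gs).
split=> //; have zd : vder z t (cderiv z t) by apply: VK1_vder.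
(* w = conj(z) z' is the logarithmic derivative, whose four coordinates are now determined one by
   one. *)
have [w wE] : exists w, cderiv z t = qmul (z t) w.
  by exists (qmul (qconj (z t)) (cderiv z t)); rewrite qmulA unit_qmulV // qmul1.
rewrite wE in zd; rewrite (_ : quat _ _ _ _ = w) //.
have dsw p q s : dot (sw (z s) (z s) p) (sw (z s) (z s) q) = dot p q by exact: dot_sw.
have wr : dot w qone = 0.
  have zw : dot (qmul (z t) w) (z t) = dot w qone.
    by rewrite -{2}(qmulq1 (z t)) dot_qmull (unit_quatP _).1 // mul1r.
  have := dot_cst_der zd zd (fun s => (unit_quatP _).1 (uz s)).
  by rewrite (dotC (z t)) zw => h; lra.
have wi : sw (z t) (z t) (qmul w qi + qmul qi (qconj w)) = speed g t *: sw (z t) (z t) qj.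
  apply: vder_unique (vder_sw (q := qi) zd zd) _; rewrite iE (fr t).2.
  have gd : vder g t (cderiv g t) by exact: smooth_vder0.
  by apply: vder_eq (vder_imq gd) _; rewrite tangentE // imqZ.
have wj : kappa g t = dot (qmul w qj + qmul qj (qconj w)) qk / speed g t.
  rewrite /kappa; congr (_ / _).
  have -> : frenet_col 1 g = fun s => im3 (sw (z s) (z s) qj).
    by apply/funext => s; rewrite /frenet_col -FE col_Pi3E.
  rewrite (cderivE (vder_im3 (vder_sw (q := qj) zd zd))) /frenet_col -FE col_Pi3E.
  rewrite dotC dot_im3_sw ?basis_real // dotC //.
have wik : dot (qmul w qi + qmul qi (qconj w)) qk = 0.
  by rewrite -(dsw _ _ t) wi dotZl dsw dot_basis mulr0.
have wij : dot (qmul w qi + qmul qi (qconj w)) qj = speed g t.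
  by rewrite -(dsw _ _ t) wi dotZl dsw dot_basis mulr1.
(* For w = a + b i + c j + d k: |z| = 1 gives a = 0, the derivative of z i conj(z) gives c = 0 and 2
   d = v, and that of z j conj(z) gives 2 b = v kappa. *)
rewrite wj mulrCA mulfV ?gt_eqF // mulr1 -wij; move: wr wik {wi wj wij wE zd}.
have [a [b [c [d ->]]]] := quat_surj w.
rewrite /qi /qj /qk /qone !qconj_quat !qmul_quat !quatD !dot_quat => wr wik.
by congr quat; lra.
Qed.

End BackwardMap.

(** * From pairs of curves in S^2 to curves in S^3 *)

Section BackwardCurve.
Context {R : realType}.
Local Notation I := (I01 R).

Lemma backward_curve (gl gr : I -> 'cV[R]_3) zl zr :
  smooth gl -> on_sphere gl -> generic gl -> is_lift3 (frenet gl) zl ->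
  smooth gr -> on_sphere gr -> generic gr -> is_lift3 (frenet gr) zr ->
  (forall t, speed gl t = speed gr t) -> (forall t, kappa gr t < kappa gl t) ->
  let g t := qmul (zl t) (qconj (zr t)) in
  smooth g /\
  [/\ on_sphere g, generic g, forall t, frenet g t = Pi4 (zl t) (zr t),
      forall t, left_part g t = gl t /\ right_part g t = gr t &
      forall t, [/\ speed g t = speed gl t * (kappa gl t - kappa gr t) / 2,
                    kappa g t = 2 / (kappa gl t - kappa gr t) &
                    tau g t = (kappa gl t + kappa gr t) / (kappa gl t - kappa gr t)]].
Proof.
move=> sl sphl genl liftl sr sphr genr liftr vv kk g.
have [_ ul _ _] := liftl; have [_ ur _ _] := liftr.
have zld t := (lift3_vder t sl sphl genl liftl).2.
have zrd t := (lift3_vder t sr sphr genr liftr).2.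
pose v t := speed gl t; pose kl t := kappa gl t; pose kr t := kappa gr t.
have v0 t : 0 < v t by rewrite enorm_gt0; exact: generic_cderiv_neq0.
(* w_l - w_r = V i, the k-components v/2 being equal; V is the speed of g, positive by the
   inequality between the curvatures. *)
pose V t := v t * (kl t - kr t) / 2.
have k0 t : 0 < kl t - kr t by rewrite subr_gt0 kk.
have V0 t : 0 < V t by rewrite divr_gt0 // mulr_gt0.
pose e q t := sw (zl t) (zr t) q.
have de t p q : dot (e p t) (e q t) = dot p q by exact: dot_sw.
have gE : g = e qone by apply/funext => t; rewrite /e /sw qmulq1.
have e0d t : vder g t (V t *: e qi t).
  rewrite gE; apply: vder_eq (vder_sw (q := qone) (zld t) (zrd t)) _.
  rewrite -vv -/(v t) -/(kl t) -/(kr t) -swZ; congr sw.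
  by rewrite /qi /qone qconj_quat !qmul_quat quatD quatZ /V; congr quat; field.
(* w_l i - i w_r = - V + v j: the second Frenet entry of g is the common speed of the pair. *)
have e1d t : vder (e qi) t (- V t *: e qone t + v t *: e qj t).
  apply: vder_eq (vder_sw (q := qi) (zld t) (zrd t)) _.
  rewrite -vv -/(v t) -/(kl t) -/(kr t) -!swZ -swD; congr sw.
  by rewrite /qi /qj /qone qconj_quat !qmul_quat !quatZ !quatD /V; congr quat; field.
have e3d t : vder (e qk) t (- (v t * (kl t + kr t) / 2) *: e qj t).
  apply: vder_eq (vder_sw (q := qk) (zld t) (zrd t)) _.
  rewrite -vv -/(v t) -/(kl t) -/(kr t) -!swZ; congr sw.
  by rewrite /qk /qj qconj_quat !qmul_quat !quatZ !quatD; congr quat; field.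
have g1E t : cderiv g t = V t *: e qi t by exact: cderivE.
have gs : smooth g.
  have gV k : VK k (fun _ : R => g).
    by apply: VK_qmul; [|apply: VK_qconj];
      [case: (lift3_vder t0 sl sphl genl liftl)|case: (lift3_vder t0 sr sphr genr liftr)].
  exact: VK_smooth (0 : R) gV.
have g1d t : vder (cderiv g) t (cderiv (cderiv g) t).
  by apply: smooth_vder0; exact: smooth_cderiv.
(* Only the triangular shape and the positive coefficient on [e qj] matter; [a] is the derivative of
   V. *)
have g2E t : exists a, cderiv (cderiv g) t =
    - (V t * V t) *: e qone t + a *: e qi t + (V t * v t) *: e qj t.
  have [D Vd] : exists D, isder V t D.
    have VE : (fun s => dot (cderiv g s) (e qi s)) = V.
      by apply/funext => s; rewrite g1E dotZl de dot_basis mulr1.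
    by have := isder_dot (g1d t) (e1d t); rewrite VE; eexists; eassumption.
  exists D; apply: vder_unique (g1d t) _.
  rewrite (_ : cderiv g = fun s => V s *: e qi s); last by apply/funext.
  apply: vder_eq (vderZ Vd (e1d t)) _.
  by rewrite scalerDr !scalerA mulrN addrCA addrA.
have fr t : frenet g t = Pi4 (zl t) (zr t) /\ row_free (\matrix_(k < 3) (cderivn k g t)^T).
  have [a g2] := g2E t.
  apply: (@frenet_triangular _ _ _ _ _
    (fun k j => if k == 2%N then [:: - (V t * V t); a]`_j else 0)
    (fun k => [:: 1; V t; V t * v t]`_k)).
  - exact: Pi4_SO.
  - by move=> [|[|[|//]]] _ //=; rewrite mulr_gt0.
  case=> [|[|[|//]]] _ /=.
  - by rewrite big_ord0 add0r scale1r col_Pi4E /cderivn /= gE.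
  - by rewrite big_ord1 scale0r add0r col_Pi4E /cderivn /= g1E.
  - by rewrite !big_ord_recl big_ord0 addr0 /= !col_Pi4E /cderivn /= g2.
have frc j : frenet_col j g = fun t => col (inord j) (Pi4 (zl t) (zr t)).
  by apply/funext => t; rewrite /frenet_col (fr t).1.
have f1 : frenet_col 1 g = e qi by rewrite frc; apply/funext => t; rewrite col_Pi4E.
have f2 : frenet_col 2 g = e qj by rewrite frc; apply/funext => t; rewrite col_Pi4E.
have f3 : frenet_col 3 g = e qk by rewrite frc; apply/funext => t; rewrite col_Pi4E.
have spE t : speed g t = V t.
  rewrite /speed g1E enormZ ?ltW // (_ : enorm _ = 1) ?mulr1 //.
  by apply/enorm1P; rewrite de dot_basis.
split => //; split.
- by move=> t; apply/enorm1P; rewrite gE de dot_basis.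
- by move=> t; case: (fr t).
- by move=> t; case: (fr t).
- move=> t; have [-> ->] := parts_sw (ul t) (ur t) (V0 t) (congr1 (@^~ t) gE) (g1E t).
  rewrite (lift3_frame t sl sphl genl liftl).1 (lift3_frame t sr sphr genr liftr).1.
  by rewrite !im3_imq.
- move=> t; split; first exact: spE.
  + rewrite [LHS]/kappa f1 f2 spE (cderivE (e1d t)) dotDl !dotZl !de !dot_basis.
    rewrite mulr0 add0r mulr1 /V -/(kl t) -/(kr t).
    have := k0 t; have := v0 t; move: (v t) (kl t) (kr t) => a b c a0 bc0.
    by field; rewrite !gt_eqF.
  + rewrite /tau f2 f3 spE (cderivE (e3d t)) dotZl de dot_basis mulr1 opprK /V.
    rewrite -/(kl t) -/(kr t).
    have := k0 t; have := v0 t; move: (v t) (kl t) (kr t) => a b c a0 bc0.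
    by field; rewrite !gt_eqF.
Qed.

End BackwardCurve.

(** * The correspondence between the curve spaces *)

Section CurveSpaces.
Context {R : realType} (zl zr : 'cV[R]_4).
Local Notation I := (I01 R).

Lemma GS3P K (c : GS3 K zl zr) : smooth (curve3 c) /\ in_GS3 zl zr (curve3 c).
Proof. by split; [have := valP (val c)|have := valP c]; rewrite inE. Qed.

Lemma GS2P K (z : 'cV[R]_4) (c : GS2 K z) : smooth (curve2 c) /\ in_GS2 z (curve2 c).
Proof. by split; [have := valP (val c)|have := valP c]; rewrite inE. Qed.

Lemma GS2pairsP K (p : GS2pairs K zl zr) t :
  speed (left_curve p) t = speed (right_curve p) t /\
  kappa (right_curve p) t < kappa (left_curve p) t.
Proof. by have := valP p; rewrite inE; exact. Qed.

Lemma curve3_inj K : injective (@curve3 R K zl zr).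
Proof. by move=> c c' cc'; do 2 apply: val_inj. Qed.

Lemma curve2_inj K (z : 'cV[R]_4) : injective (@curve2 R K z).
Proof. by move=> c c' cc'; do 2 apply: val_inj. Qed.

Lemma left_right_inj K (p p' : GS2pairs K zl zr) :
  left_curve p = left_curve p' -> right_curve p = right_curve p' -> p = p'.
Proof.
move=> ll rr; apply: val_inj.
rewrite [LHS]surjective_pairing [RHS]surjective_pairing.
by congr (_, _); exact: curve2_inj.
Qed.

Lemma GS3_exists K (g : I -> 'cV[R]_4) : smooth g -> in_GS3 zl zr g ->
  exists c : GS3 K zl zr, curve3 c = g.
Proof.
move=> gs gG; pose s : smooth_curve R K 3 := exist _ g (mem_set gs).
have sG : GS3 K zl zr s by [].
by exists (exist _ s (mem_set sG)).
Qed.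

Lemma GS2_exists K (z : 'cV[R]_4) (g : I -> 'cV[R]_3) : smooth g -> in_GS2 z g ->
  exists c : GS2 K z, curve2 c = g.
Proof.
move=> gs gG; pose s : smooth_curve R K 2 := exist _ g (mem_set gs).
have sG : GS2 K z s by [].
by exists (exist _ s (mem_set sG)).
Qed.

Lemma GS2pairs_exists K (gl gr : I -> 'cV[R]_3) :
  smooth gl -> in_GS2 zl gl -> smooth gr -> in_GS2 zr gr ->
  (forall t, speed gl t = speed gr t /\ kappa gr t < kappa gl t) ->
  exists p : GS2pairs K zl zr, left_curve p = gl /\ right_curve p = gr.
Proof.
move=> sl Gl sr Gr lr.
have [cl clE] := GS2_exists K sl Gl; have [cr crE] := GS2_exists K sr Gr.
have pG : GS2pairs K zl zr (cl, cr) by move=> t; rewrite /= clE crE.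
by exists (exist _ (cl, cr) (mem_set pG)).
Qed.

Lemma VK_tangent (X : topologicalType) m k (g : X -> I -> 'cV[R]_m.+1) :
  (forall x t, cderiv (g x) t != 0) -> VK k.+1 g -> VK k (fun x => tangent (g x)).
Proof. by move=> g1 gk; apply: VK_normalize => //; have [] := VK_cderiv gk. Qed.

Lemma VK_parts (X : topologicalType) k (g : X -> I -> 'cV[R]_4) :
  (forall x t, cderiv (g x) t != 0) -> VK k.+1 g ->
  VK k (fun x => left_part (g x)) /\ VK k (fun x => right_part (g x)).
Proof.
move=> g1 gk; have tk := VK_tangent g1 gk.
have ck : VK k (fun x s => qconj (g x s)) by apply: VK_qconj; exact: VK_le (leqnSn k) gk.
by split; apply: VK_im3; exact: VK_qmul.
Qed.

Lemma smooth_parts (g : I -> 'cV[R]_4) : smooth g -> generic g ->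
  smooth (left_part g) /\ smooth (right_part g).
Proof.
move=> gs gen.
have parts k := @VK_parts R k (fun _ => g)
  (fun _ t => generic_cderiv_neq0 t gen) (smooth_VK _ gs).
split.
  exact: (@VK_smooth R R 2 (fun _ => left_part g) 0 (fun k => (parts k).1)).
exact: (@VK_smooth R R 2 (fun _ => right_part g) 0 (fun k => (parts k).2)).
Qed.

Lemma continuous_into_sub (X T : topologicalType) (A : set T) (f : X -> A) :
  continuous (fun x => val (f x)) -> continuous f.
Proof. exact: continuous_comp_initial. Qed.

Lemma continuous_pair (X T U : topologicalType) (f : X -> T * U) :
  continuous (fun x => (f x).1) -> continuous (fun x => (f x).2) -> continuous f.
Proof.
move=> f1 f2 x P [[A B] /= [Ax Bx] AB].
have [fA fB] := (f1 x _ Ax, f2 x _ Bx).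
suff : nbhs x (f @^-1` P) by [].
apply: (@filterS _ _ (nbhs_filter x)) (@filterI _ _ (nbhs_filter x) _ _ fA fB) => y [Ay By].
by apply: (AB (f y)).
Qed.

Lemma GS3_VK K k : (forall i, (i <= k)%N -> K i) ->
  VK k (fun c : GS3 K zl zr => curve3 c).
Proof. by move=> Kk; apply: (smooth_curve_VK Kk); exact: initial_continuous. Qed.

Lemma GS2pairs_VK K k : (forall i, (i <= k)%N -> K i) ->
  VK k (fun p : GS2pairs K zl zr => left_curve p) /\
  VK k (fun p : GS2pairs K zl zr => right_curve p).
Proof.
move=> Kk.
have vc : continuous (fun p : GS2pairs K zl zr => val p) by exact: initial_continuous.
split.
  apply: (@smooth_curve_VK R (GS2pairs K zl zr) K 2 k (fun p => val (val p).1) Kk) => p.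
  apply: (@continuous_comp _ _ _ (fun p : GS2pairs K zl zr => (val p).1) val).
    apply: (@continuous_comp _ _ _ (fun p : GS2pairs K zl zr => val p) fst).
      exact: vc.
    exact: cvg_fst.
  exact: initial_continuous.
apply: (@smooth_curve_VK R (GS2pairs K zl zr) K 2 k (fun p => val (val p).2) Kk) => p.
apply: (@continuous_comp _ _ _ (fun p : GS2pairs K zl zr => (val p).2) val).
  apply: (@continuous_comp _ _ _ (fun p : GS2pairs K zl zr => val p) snd).
    exact: vc.
  exact: cvg_snd.
exact: initial_continuous.
Qed.

(** The tangent in both parts costs one order, whence the hypothesis relating K and K'. It holds for
    [Cinfty] on both sides and for [Ck k.+1] against [Ck k]. *)
Lemma parts_continuous K K' (f : GS3 K zl zr -> GS2pairs K' zl zr) :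
  (forall k i, K' k -> (i <= k.+1)%N -> K i) ->
  (forall c, left_curve (f c) = left_part (curve3 c)) ->
  (forall c, right_curve (f c) = right_part (curve3 c)) -> continuous f.
Proof.
move=> KK' fl fr.
have parts k : K' k -> VK k (fun c : GS3 K zl zr => left_part (curve3 c)) /\
    VK k (fun c : GS3 K zl zr => right_part (curve3 c)).
  move=> K'k; apply: VK_parts.
    by move=> c t; apply: generic_cderiv_neq0; have [_ []] := GS3P c.
  by apply: GS3_VK => i; exact: KK'.
apply: continuous_into_sub; apply: continuous_pair;
  apply: continuous_into_sub; apply: smooth_curve_continuous => k /parts[kl kr].
  by move: kl; congr VK; apply/funext => c; rewrite -fl.
by move: kr; congr VK; apply/funext => c; rewrite -fr.
Qed.

(** The order is lost in the frames, whose second column is the tangent. The lifts are chosen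
    separately for each pair, yet [lift_VK] makes them vary continuously with it. *)
Lemma lift_quotient_continuous K K' (f : GS2pairs K zl zr -> GS3 K' zl zr) :
  (forall k i, K' k -> (i <= k.+1)%N -> K i) ->
  (forall p, exists ql qr, [/\ is_lift3 (frenet (left_curve p)) ql,
     is_lift3 (frenet (right_curve p)) qr &
     curve3 (f p) = fun t => qmul (ql t) (qconj (qr t))]) -> continuous f.
Proof.
move=> KK' /choice[ql /choice[qr qlr]].
apply: continuous_into_sub; apply: smooth_curve_continuous => k K'k.
have [lk rk] := GS2pairs_VK (fun i => @KK' k i K'k).
have lift_k (g : GS2pairs K zl zr -> I -> 'cV[R]_3) z q :
    (forall p, [/\ smooth (g p), in_GS2 z (g p) & is_lift3 (frenet (g p)) (q p)]) ->
    VK k.+1 g -> VK k q.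
  move=> gq gk; have lift p : is_lift3 (frenet (g p)) (q p) by case: (gq p).
  have fr p t : sw (q p t) (q p t) qi = imq (g p t) /\
                sw (q p t) (q p t) qj = imq (tangent (g p) t).
    by have [? [? ? _ _] ?] := gq p; exact: lift3_frame.
  apply: lift_VK => [p|p|p||]; try by have [] := lift p.
    rewrite (_ : (fun p t => _) = fun p t => imq (g p t)).
      by apply: VK_imq; exact: VK_le (leqnSn k) gk.
    by apply/funext => p; apply/funext => t; case: (fr p t).
  rewrite (_ : (fun p t => _) = fun p t => imq (tangent (g p) t)).
    apply: VK_imq; apply: VK_tangent => // p t.
    by apply: generic_cderiv_neq0; have [_ []] := gq p.
  by apply/funext => p; apply/funext => t; case: (fr p t).
have qlk : VK k ql.
  apply: (lift_k _ zl _ _ lk) => p; have [? _ _] := qlr p.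
  by have [] := GS2P (val p).1.
have qrk : VK k qr.
  apply: (lift_k _ zr _ _ rk) => p; have [_ ? _] := qlr p.
  by have [] := GS2P (val p).2.
have : VK k (fun p t => qmul (ql p t) (qconj (qr p t))).
  by apply: VK_qmul => //; exact: VK_qconj.
by congr VK; apply/funext => p; have [_ _ <-] := qlr p.
Qed.

End CurveSpaces.

Section Correspondence.
Context {R : realType} (zl zr : 'cV[R]_4).
Local Notation I := (I01 R).

(** The two components of the lift of the frame of c are lifts of the frames of its parts, so the
    final values are [zl] and [zr]. *)
Lemma parts_exist K (c : GS3 K zl zr) : exists p : GS2pairs K zl zr,
  left_curve p = left_part (curve3 c) /\ right_curve p = right_part (curve3 c).
Proof.
have [gs [sph gen F1 [ql [qr [lift [qlE qrE]]]]]] := GS3P c.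
have [km0 _ [l1 l2 l3 l4 l5] [r1 r2 r3 r4 r5]] := forward_curves gs sph gen lift.
have [sl sr] := smooth_parts gs gen.
have [[qlc qrc] u [ql0 qr0] _] := lift.
have km t : 0 < kappa (curve3 c) t.
  have v0 : 0 < speed (curve3 c) t by rewrite enorm_gt0; exact: generic_cderiv_neq0.
  by rewrite -(pmulr_rgt0 _ v0).
have Gl : in_GS2 zl (left_part (curve3 c)).
  split; [exact: l1|exact: l2|by rewrite l3 ql0 Pi3_1|exists ql; split; last exact: qlE].
  by split; [exact: qlc|move=> t; case: (u t)|exact: ql0|move=> t; rewrite l3].
have Gr : in_GS2 zr (right_part (curve3 c)).
  split; [exact: r1|exact: r2|by rewrite r3 qr0 Pi3_1|exists qr; split; last exact: qrE].
  by split; [exact: qrc|move=> t; case: (u t)|exact: qr0|move=> t; rewrite r3].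
apply: (GS2pairs_exists K sl Gl sr Gr) => t.
by rewrite l4 r4 l5 r5 ltr_pM2r ?invr_gt0 //; split=> //; lra.
Qed.

Lemma quotient_exists K (p : GS2pairs K zl zr) : exists (c : GS3 K zl zr) ql qr,
  [/\ is_lift3 (frenet (left_curve p)) ql, is_lift3 (frenet (right_curve p)) qr &
      curve3 c = fun t => qmul (ql t) (qconj (qr t))].
Proof.
have [sl [sphl genl Fl [ql [liftl ql1]]]] := GS2P (val p).1.
have [sr [sphr genr Fr [qr [liftr qr1]]]] := GS2P (val p).2.
have vv t := (GS2pairsP p t).1; have kk t := (GS2pairsP p t).2.
have [gs [b1 b2 b3 _ _]] := backward_curve sl sphl genl liftl sr sphr genr liftr vv kk.
have [qlc qlu ql0 _] := liftl; have [qrc qru qr0 _] := liftr.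
have gG : in_GS3 zl zr (fun t => qmul (ql t) (qconj (qr t))).
  split=> //; first by rewrite b3 ql0 qr0 Pi4_1.
  by exists ql, qr; split; [split|rewrite ql1 qr1].
have [c cg] := GS3_exists K gs gG.
by exists c, ql, qr; split; [exact: liftl|exact: liftr|exact: cg].
Qed.

End Correspondence.

Theorem theoremA (R : realType) (zl zr : 'cV[R]_4)
    (hzl : unit_quat zl) (hzr : unit_quat zr) :
  exists (Phi : GS3 Cinfty zl zr -> GS2pairs Cinfty zl zr)
         (Psi : GS2pairs Cinfty zl zr -> GS3 Cinfty zl zr),
    [/\ [/\ cancel Phi Psi, cancel Psi Phi, continuous Phi & continuous Psi],
        forall k : nat, (3 <= k)%N ->
          continuous (Phi : GS3 (Ck k.+1) zl zr -> GS2pairs (Ck k) zl zr) /\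
          continuous (Psi : GS2pairs (Ck k.+1) zl zr -> GS3 (Ck k) zl zr),
        forall (c : GS3 Cinfty zl zr) (t : I01 R),
          let g := curve3 c in
          let gl := left_curve (Phi c) in
          let gr := right_curve (Phi c) in
          [/\ speed gl t = speed g t * kappa g t,
              speed gr t = speed g t * kappa g t,
              kappa gl t = (tau g t + 1) / kappa g t
            & kappa gr t = (tau g t - 1) / kappa g t]
      & forall (p : GS2pairs Cinfty zl zr) (t : I01 R),
          let gl := left_curve p in
          let gr := right_curve p in
          let g := curve3 (Psi p) in
          [/\ speed g t = speed gl t * (kappa gl t - kappa gr t) / 2,
              kappa g t = 2 / (kappa gl t - kappa gr t)
            & tau g t = (kappa gl t + kappa gr t) / (kappa gl t - kappa gr t)]].
Proof.
have [Phi PhiE] := choice (@parts_exist R zl zr Cinfty).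
have [Psi PsiE] := choice (@quotient_exists R zl zr Cinfty).
have PsiPhi (p : GS2pairs Cinfty zl zr) :
    [/\ forall t, left_part (curve3 (Psi p)) t = left_curve p t /\
                  right_part (curve3 (Psi p)) t = right_curve p t &
        forall t, let gl := left_curve p in let gr := right_curve p in
          let g := curve3 (Psi p) in
          [/\ speed g t = speed gl t * (kappa gl t - kappa gr t) / 2,
              kappa g t = 2 / (kappa gl t - kappa gr t)
            & tau g t = (kappa gl t + kappa gr t) / (kappa gl t - kappa gr t)]].
  have [ql [qr [liftl liftr ->]]] := PsiE p.
  have [sl [sphl genl _ _]] := GS2P (val p).1.
  have [sr [sphr genr _ _]] := GS2P (val p).2.
  have vv t := (GS2pairsP p t).1; have kk t := (GS2pairsP p t).2.
  by have [_ []] := backward_curve sl sphl genl liftl sr sphr genr liftr vv kk.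
have prefix k i : Ck k i -> forall j, (j <= i.+1)%N -> Ck k.+1 j.
  by move=> ik j /leq_trans; apply; rewrite ltnS.
exists Phi, Psi; split.
- split.
  (* The lifts chosen for the pair [Phi c] coincide, by uniqueness, with the components of the lift
     of the frame of c, so their quotient is c again. *)
  + move=> c; apply: curve3_inj.
    have [ql [qr [liftl liftr ->]]] := PsiE (Phi c).
    have [gs [sph gen _ [zlt [zrt [lift _]]]]] := GS3P c.
    have [_ gE [_ _ l3 _ _] [_ _ r3 _ _]] := forward_curves gs sph gen lift.
    have [[zlc zrc] u [zl0 zr0] _] := lift.
    have [lE rE] := PhiE c.
    have [qlc qlu ql0 qlF] := liftl; have [qrc qru qr0 qrF] := liftr.
    have -> : ql = zlt.
      apply: lift_unique => // [t||t]; first by case: (u t).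
        by rewrite ql0 zl0.
      by rewrite qlF lE l3.
    have -> : qr = zrt.
      apply: lift_unique => // [t||t]; first by case: (u t).
        by rewrite qr0 zr0.
      by rewrite qrF rE r3.
    by rewrite gE.
  + move=> p; have [lE rE] := PhiE (Psi p); have [lr _] := PsiPhi p.
    by apply: left_right_inj; [rewrite lE|rewrite rE]; apply/funext => t; case: (lr t).
  + by apply: (@parts_continuous R zl zr Cinfty Cinfty) => // c; case: (PhiE c).
  + by apply: (@lift_quotient_continuous R zl zr Cinfty Cinfty Psi) => //.
(* The carriers do not depend on the set of orders, so the same functions are reread between the
   C^(k+1) and C^k topologies. *)
- move=> k _; split.
  + by apply: (@parts_continuous R zl zr (Ck k.+1) (Ck k) Phi) =>
      [i j /prefix|c|c]; [exact|case: (PhiE c)..].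
  + apply: (@lift_quotient_continuous R zl zr (Ck k.+1) (Ck k) Psi) => //.
    by move=> i j /prefix; exact.
- move=> c t g gl gr.
  have [gs [sph gen _ [zlt [zrt [lift _]]]]] := GS3P c.
  have [_ _ [_ _ _ l4 l5] [_ _ _ r4 r5]] := forward_curves gs sph gen lift.
  by rewrite /gl /gr; have [-> ->] := PhiE c.
- by move=> p t; have [_] := PsiPhi p; exact.
Qed.
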